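(* Let $x_1,\dots,x_n$, $a_1,\dots,a_n$, and $c_1,\dots,c_{n-1}$ be indeterminates. For each $j=1,\dots,n$, let $P_j$ be an $A_{j-1}$ theta function of norm $(c_1\cdots c_{n-1}a_{j+1}\cdots a_n)^{-1}$. Then $$\det_{1\leq i,j\leq n}\left(x_i^{1-n}\prod_{k=1}^{n-1}\theta(c_kx_i)\,P_j(x_i)\prod_{k=j+1}^n\theta(a_kx_i)-x_i^{n}\prod_{k=1}^{n-1}\theta(c_kx_i^{-1})\,P_j(x_i^{-1})\prod_{k=j+1}^n\theta(a_kx_i^{-1})\right)$$ $$=-\frac{2\,a_1\cdots a_n\,c_1\cdots c_{n-1}}{\theta(c_1\cdots c_{n-1}a_1\cdots a_n)}\prod_{i=1}^nP_i(1/a_i)\prod_{i=1}^{n-1}\bigl(\theta(-c_i)\,\theta(pc_i^2;p^2)\bigr)\prod_{1\leq i<j\leq n-1}\theta(c_ic_j)\prod_{i=1}^n\theta(x_i)\prod_{1\le i<j\le n}a_jx_i^{-1}\,\theta(x_ix_j^{\pm}).$$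
   Context: Fix $p\in\mathbb C$ with $0<|p|<1$. Put $(a;q)_\infty=\prod_{j\ge0}(1-aq^j)$, $\theta(x;q)=(x;q)_\infty(q/x;q)_\infty$ for $x\ne0$, $\theta(x)=\theta(x;p)$, and $\theta(xy^{\pm})=\theta(xy)\theta(x/y)$. A function $f$ holomorphic on $\mathbb C\setminus\{0\}$ is called an $A_{m-1}$ theta function of norm $s$ (with $m\ge1$ and $s\in\mathbb C\setminus\{0\}$) if $f(px)=\frac{(-1)^m}{s x^m}f(x)$ for all $x\neq0$. ''Indeterminates'' are understood as nonzero complex numbers, assumed generic so that no denominators vanish. *)

(* Defs.v *)
From mathcomp Require Export all_boot all_order all_algebra.
From mathcomp Require Export all_classical all_reals all_analysis.
From mathcomp Require Export complex.
Export Order.TTheory GRing.Theory Num.Theory.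
Export numFieldNormedType.Exports.

Set Implicit Arguments.
Unset Strict Implicit.
Unset Printing Implicit Defensive.

Local Open Scope classical_set_scope.
Local Open Scope ring_scope.
Local Open Scope complex_scope.

(* The field of complex numbers is [R[i]] for [R : realType]. Its norm topology
   is carried by the alias [R[i]^o], hence the casts to [R[i]^o] below. *)

(* (a; q)_oo, meaningful for `|q| < 1 *)
Definition qpoch (R : realType) (q a : R[i]) : R[i] :=
  limn (fun N : nat => \prod_(j < N) (1 - a * q ^+ j) : R[i]^o).

(* theta(x; q), for x != 0; the nome comes first *)
Definition theta (R : realType) (q x : R[i]) : R[i] :=
  qpoch q x * qpoch q (q / x).

(* theta(x y^{+-}; q) *)
Definition theta_pm (R : realType) (q x y : R[i]) : R[i] :=
  theta q (x * y) * theta q (x / y).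

(* Since the scalars are complex, derivability in the direction 1 is complex
   differentiability. *)
Definition holomorphic_punctured (R : realType) (f : R[i] -> R[i]) : Prop :=
  forall z : R[i], z != 0 -> derivable (f : R[i]^o -> R[i]^o) z 1.

(* [A_theta p m s f]: f is an A_{m-1} theta function of norm s; note the shift
   between m and the index of the root system. The value of f at 0 is
   irrelevant. *)
Definition A_theta (R : realType) (p : R[i]) (m : nat) (s : R[i])
    (f : R[i] -> R[i]) : Prop :=
  [/\ (0 < m)%N, s != 0, holomorphic_punctured f &
      forall x : R[i], x != 0 ->
        f (p * x) = (-1) ^+ m / (s * x ^+ m) * f x].

(* Main.v *)
Require Import Defs.
From mathcomp Require Import perm ring lra.

(** Write [theta] for the theta function of nome [p] and put
    [F_j(t) = P_j(t) prod_(k > j) theta(a_k t)]. All the [F_j] are theta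
    functions of the same degree [n] and the same norm [1 / prod c]. The matrix
    folds each of them under [t -> 1/t] with explicit weights, so expanding the
    determinant by multilinearity in its rows gives a sum over sign patterns of
    products of weights times determinants [det (F_j(y_i))], where [y_i] is
    [x_i] or [1/x_i].

    Such a determinant is of type A: up to a constant [K], which depends on the
    [P_j] and the [a_k] but not on [y], it equals
    [theta(prod y / prod c) prod_(i < j) y_j theta(y_i / y_j)]
    ([typeA_determinant]). So [K] comes out of the sum, and what is left is an
    identity between explicit products in [x] and [c] ([fold_sum_eval]).

    Both evaluations go by induction on the size and interpolate in the last
    variable. The two sides are theta functions of that variable with the same
    degree and norm, they vanish when it meets another variable (or, after
    folding, the inverse of one), and at one further point, [1/a_n] or
    [1/c_(n-1)], the identity is the one of smaller size: at [1/a_n] the last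
    row keeps a single entry, and at [1/c_(n-1)] one of the two signs is killed.
    A theta function of degree [m] with [m] zeros in general position is zero
    ([theta_space_vanish]), which concludes for generic variables; the others
    are limits of generic ones along [x_i exp(nu_i t)]
    ([near0_generic_points]). The product over [i < j] of the [theta(c_i c_j)]
    and the factors [theta(-c_i) theta(p c_i^2; p^2)] are collected in this
    induction, through [theta(c^2) = theta(c) theta(-c) theta(p c^2; p^2)].

    The vanishing statement is where analysis enters, and only pointwise complex
    differentiability is assumed. Let [T] be the product of thetas with the
    prescribed zeros. In the coordinate [log x], and after multiplication by an
    exponential, [f / T] has a doubly periodic modulus, so this modulus has a
    maximum and [f / T] is constant ([quotient_liouville]). The maximum
    principle used there is a mean value property, which comes from Goursat's
    bisection argument on rectangles in the coordinate [log (w - w0)]. In that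
    coordinate the centre [w0] is at infinity, so continuity at [w0] is enough,
    and the removable singularities of [f / T] cost nothing. *)

Import ComplexField.Normc.

Set Implicit Arguments.
Unset Strict Implicit.
Unset Printing Implicit Defensive.

Local Open Scope classical_set_scope.
Local Open Scope ring_scope.
Local Open Scope complex_scope.

Local Notation Re := complex.Re.
Local Notation Im := complex.Im.

(** * Continuity and complex differentiability at a point *)

Definition ccont (K : numFieldType) (f : K -> K) (z : K) :=
  {for z, continuous (f : K^o -> K^o)}.

Section Calculus.
Context {K : numFieldType}.
Implicit Types (z w a b : K) (f g : K -> K).

Lemma ccont_cst a z : ccont (fun=> a) z.
Proof. exact: (@cst_continuous K^o K^o). Qed.

Lemma ccont_id z : ccont id z.
Proof. by []. Qed.

Lemma ccontD f g z : ccont f z -> ccont g z -> ccont (fun w => f w + g w) z.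
Proof. exact: (@continuousD K K^o K^o). Qed.

Lemma ccontN f z : ccont f z -> ccont (fun w => - f w) z.
Proof. exact: (@continuousN K K^o K^o). Qed.

Lemma ccontM f g z : ccont f z -> ccont g z -> ccont (fun w => f w * g w) z.
Proof. exact: (@continuousM K K^o). Qed.

Lemma ccontV f z : f z != 0 -> ccont f z -> ccont (fun w => (f w)^-1) z.
Proof. exact: (@continuousV K K^o). Qed.

Lemma ccont_comp f g z : ccont g z -> ccont f (g z) ->
  ccont (fun w => f (g w)) z.
Proof. exact: (@continuous_comp K^o K^o K^o). Qed.

Lemma ccont_prod (I : Type) (r : seq I) (P : pred I) (F : I -> K -> K) z :
  (forall i, P i -> ccont (F i) z) -> ccont (fun w => \prod_(i <- r | P i) F i w) z.
Proof.
move=> H; elim: r => [|i r IH].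
  by under eq_fun do rewrite big_nil; exact: ccont_cst.
under eq_fun do rewrite big_cons.
case: ifP => [Pi|_]; last exact: IH.
by apply: ccontM; [exact: H|exact: IH].
Qed.

(** Complex differentiability in Caratheodory's form: the chain and product
    rules become algebraic identities between slope functions. *)
Definition cderiv f z l := exists phi : K -> K,
  [/\ forall w, f w - f z = phi w * (w - z),
      ccont phi z & phi z = l].

Lemma cderiv_cont f z l : cderiv f z l ->
  ccont f z.
Proof.
case=> phi [fE cphi _].
have -> : f = (fun w => f z + phi w * (w - z)).
  by apply/funext => w; rewrite -fE addrCA subrr addr0.
apply: ccontD; first exact: ccont_cst.
apply: ccontM => //; apply: ccontD; [exact: ccont_id|exact: ccont_cst].
Qed.

Lemma cderiv_cst a z : cderiv (fun=> a) z 0.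
Proof.
exists (fun=> 0); split => // [w|]; first by rewrite subrr mul0r.
exact: ccont_cst.
Qed.

Lemma cderiv_id z : cderiv id z 1.
Proof. by exists (fun=> 1); split => // [w|]; [rewrite mul1r|exact: ccont_cst]. Qed.

Lemma cderivD f g z a b : cderiv f z a -> cderiv g z b ->
  cderiv (fun w => f w + g w) z (a + b).
Proof.
move=> [u [fE cu <-]] [v [gE cv <-]].
exists (fun w => u w + v w); split => // [w|]; last exact: ccontD.
by rewrite mulrDl -fE -gE opprD addrACA.
Qed.

Lemma cderivM f g z a b : cderiv f z a -> cderiv g z b ->
  cderiv (fun w => f w * g w) z (f z * b + a * g z).
Proof.
move=> df dg; have cg := cderiv_cont dg.
move: df dg => [u [fE cu <-]] [v [gE cv <-]].
exists (fun w => f z * v w + u w * g w); split => // [w|].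
  rewrite mulrDl -mulrA -gE mulrAC -fE; ring.
by apply: ccontD; apply: ccontM => //; exact: ccont_cst.
Qed.

Lemma cderivZ f k z a : cderiv f z a -> cderiv (fun w => k * f w) z (k * a).
Proof.
by move=> /(cderivM (cderiv_cst k z)); rewrite mul0r addr0.
Qed.

Lemma cderiv_comp f g z a b : cderiv g z b -> cderiv f (g z) a ->
  cderiv (fun w => f (g w)) z (a * b).
Proof.
move=> dg [u [fE cu <-]]; have cg := cderiv_cont dg.
move: dg => [v [gE cv <-]].
exists (fun w => u (g w) * v w); split => // [w|].
  by rewrite fE gE mulrA.
by apply: ccontM => //; exact: ccont_comp.
Qed.

End Calculus.

Section ComplexBasics.
Context {R : realType}.
Implicit Types (x y z w a b : R[i]) (f g : R[i] -> R[i]).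

Lemma normrc z : `|z| = (normc z)%:C.
Proof. by case: z. Qed.

Lemma normc_ge0 z : 0 <= normc z.
Proof. by case: z => a b; exact: sqrtr_ge0. Qed.

Lemma normc_eq0 z : (normc z == 0) = (z == 0).
Proof. by apply/eqP/eqP => [/eq0_normc|->]; rewrite ?normc0. Qed.

Lemma normc_gt0 z : (0 < normc z) = (z != 0).
Proof. by rewrite lt_neqAle normc_ge0 andbT eq_sym normc_eq0. Qed.

Lemma normcB z w : normc (z - w) = normc (w - z).
Proof. by rewrite -(normcN (z - w)) opprB. Qed.

Lemma ler_normcB z w : normc (z - w) <= normc z + normc w.
Proof. by rewrite -(normcN w); exact: le_normcD. Qed.

Lemma normc_real (r : R) : normc r%:C = `|r|.
Proof. by rewrite /= expr0n /= addr0 sqrtr_sqr. Qed.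

Lemma normcX z n : normc (z ^+ n) = normc z ^+ n.
Proof.
by elim: n => [|n IH]; rewrite ?expr0 ?normc1 // !exprS normcM IH.
Qed.

Lemma Re_le_normc z : `|Re z| <= normc z.
Proof. by rewrite -lecR -normrc normc_ge_Re. Qed.

Lemma Im_le_normc z : `|Im z| <= normc z.
Proof.
case: z => a b /=; rewrite -sqrtr_sqr ler_wsqrtr // lerDr; exact: sqr_ge0.
Qed.

Lemma normc_le_ReIm z : normc z <= `|Re z| + `|Im z|.
Proof.
rewrite [X in normc X]complexE; apply: (le_trans (le_normcD _ _)).
rewrite normcM !normc_real; apply: lerD => //.
by rewrite /= expr0n expr1n /= add0r sqrtr1 mul1r.
Qed.

Lemma nbhs_normc z (A : set R[i]) :
  nbhs (z : R[i]^o) A <->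
  exists2 d : R, 0 < d & forall w, normc (w - z) < d -> A w.
Proof.
split=> [/nbhs_ballP[e /= e0 H]|[d d0 H]].
  have eR : e = (Re e)%:C.
    by rewrite RRe_real // ger0_real // ltW.
  exists (Re e); first by rewrite -ltcR -eR.
  move=> w wd; apply: H; rewrite /ball /= /ball_ /= normrc eR ltcR.
  by rewrite normcB.
apply/nbhs_ballP; exists d%:C; first by rewrite /= ltcR.
by move=> w; rewrite /ball /= /ball_ /= normrc ltcR normcB; exact: H.
Qed.

Lemma cont_normcP f z :
  ccont f z <->
  forall e : R, 0 < e -> exists2 d : R, 0 < d &
    forall w, normc (w - z) < d -> normc (f w - f z) < e.
Proof.
split=> [cf e e0|H].
  have /cf/nbhs_normc[d d0 dP] :
      nbhs (f z : R[i]^o) (fun u => normc (u - f z) < e).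
    by apply: (nbhs_normc _ _).2; exists e.
  by exists d.
move=> A /nbhs_normc[e e0 eA]; have [d d0 dP] := H e e0.
by apply: (nbhs_normc _ _).2; exists d => // w /dP /eA.
Qed.

Lemma derivable_cderiv f z : derivable (f : R[i]^o -> R[i]^o) z 1 ->
  exists l, cderiv f z l.
Proof.
move=> /cvg_ex[/= l H]; exists l.
exists (fun w => if w == z then l else (f w - f z) / (w - z)); split.
- move=> w; case: eqVneq => [->|wz]; first by rewrite !subrr mulr0.
  by rewrite divfK // subr_eq0.
- apply/cont_normcP => e e0.
  have /H[d /= d0 dP] : nbhs (l : R[i]^o) (fun u => normc (u - l) < e).
    by apply: (nbhs_normc _ _).2; exists e.
  have dR : d = (Re d)%:C by rewrite RRe_real // ger0_real // ltW.
  exists (Re d); first by rewrite -ltcR -dR.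
  move=> w wd; rewrite eqxx; case: eqVneq => [_|wz].
    by rewrite subrr normc0.
  have /= := dP (w - z); rewrite sub0r normrN normrc dR ltcR => /(_ wd).
  rewrite subr_eq0 => /(_ wz).
  rewrite /GRing.scale /= mulr1 subrK mulrC.
  by [].
- by rewrite eqxx.
Qed.

Lemma cderivV z : z != 0 -> cderiv (fun w => w^-1) z (- z ^- 2).
Proof.
move=> z0; exists (fun w => if w == 0 then z^-2 else - (w * z)^-1); split.
- move=> w; case: eqVneq => [->|w0].
    by rewrite invr0 !sub0r mulrN expr2 invfM -mulrA mulVf // mulr1.
  rewrite invfM; field; exact/andP.
- have : ccont (fun w => - (w * z)^-1) z.
    apply/ccontN/ccontV; first by rewrite mulf_neq0.
    by apply: ccontM; [exact: ccont_id|exact: ccont_cst].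
  move=> /cont_normcP H; apply/cont_normcP => e /H[d d0 dP].
  exists (Num.min d (normc z)); first by rewrite lt_min d0 normc_gt0.
  move=> w; rewrite lt_min => /andP[wd wz]; rewrite (negPf z0).
  case: eqVneq => [w0|w0]; last exact: dP.
  by rewrite w0 sub0r normcN ltxx in wz.
- by rewrite (negPf z0) expr2.
Qed.

Lemma cderiv_neq0_near f z l : cderiv f z l -> f z != 0 \/ l != 0 ->
  exists2 d : R, 0 < d &
    forall w, normc (w - z) < d -> w != z -> f w != 0.
Proof.
move=> df; have [fz|fz _] := eqVneq (f z) 0; last first.
  have /cont_normcP/(_ (normc (f z))) := cderiv_cont df.
  rewrite normc_gt0 => /(_ fz)[d d0 dP]; exists d => // w /dP wd _.
  by apply: contraTneq wd => ->; rewrite sub0r normcN ltxx.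
case=> // l0.
move: df => [u [fE /cont_normcP/(_ (normc l)) cu ul]].
rewrite normc_gt0 in cu; have [d d0 dP] := cu l0.
exists d => // w /dP; rewrite ul => wd wz.
have := fE w; rewrite fz subr0 => ->; rewrite mulf_neq0 // ?subr_eq0 //.
by apply: contraTneq wd => ->; rewrite sub0r normcN ltxx.
Qed.

End ComplexBasics.

(** * Goursat's argument for closed differential forms *)

Section Goursat.
Context {R : realType}.

(** The base point [lo] is kept below every abscissa in use, so that one choice
    of it gives primitives along a whole family of lines. *)
Definition primitive_from (lo : R) (g : R -> R) (x : R) : R :=
  (\int[lebesgue_measure]_(t in `[lo, x]) g t)%R.

Lemma primitive_fromP (lo : R) (g : R -> R) (x : R) :
  continuous g -> lo < x -> is_derive x 1 (primitive_from lo g) (g x).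
Proof.
move=> cg lox; have xu : x < x + 1 by rewrite ltrDl.
have ig : (@lebesgue_measure R).-integrable `[lo, x + 1] (EFin \o g).
  apply: continuous_compact_integrable; first exact: segment_compact.
  exact: continuous_subspaceT.
have [dF FE] := @continuous_FTC1_closed R g lo x (x + 1) xu ig lox (cg x).
by apply: DeriveDef; [exact: dF|rewrite -derive1E; exact: FE].
Qed.

Lemma mean_value (F g : R -> R) (a b : R) : a <= b ->
  (forall x, x \in `[a, b] -> is_derive x 1 F (g x)) ->
  exists2 x, x \in `[a, b] & F b - F a = g x * (b - a).
Proof.
move=> ab dF.
have dF' x : x \in `]a, b[ -> is_derive x 1 F (g x).
  by move=> /subset_itv_oo_cc; exact: dF.
have cF : {within `[a, b], continuous F}.
  apply: derivable_within_continuous => x xab.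
  exact: (@ex_derive _ _ _ _ _ _ _ (dF x xab)).
exact: (@MVT_segment R F g a b ab dF' cF).
Qed.

Lemma mean_value_bound (F g : R -> R) (a b k K : R) : a <= b ->
  (forall x, x \in `[a, b] -> is_derive x 1 F (g x)) ->
  (forall x, x \in `[a, b] -> `|g x - k| <= K) ->
  `|F b - F a - k * (b - a)| <= K * (b - a).
Proof.
move=> ab dF gK; have [x xab ->] := mean_value ab dF.
rewrite -mulrBl normrM (ger0_norm (_ : 0 <= b - a)) ?subr_ge0 //.
by rewrite ler_wpM2r ?subr_ge0 // gK.
Qed.

Lemma nested_intervals (u v : nat -> R) :
  (forall n, u n <= u n.+1) -> (forall n, v n.+1 <= v n) ->
  (forall n, u n <= v n) -> exists z, forall n, u n <= z <= v n.
Proof.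
move=> uS vS uv.
have um n k : u n <= u (n + k)%N.
  by elim: k => [|k IH]; rewrite ?addn0 // addnS (le_trans IH).
have vm n k : v (n + k)%N <= v n.
  by elim: k => [|k IH]; rewrite ?addn0 // addnS (le_trans _ IH).
have uvm m n : u m <= v n.
  by rewrite (le_trans (um m n)) // (le_trans (uv _)) // addnC vm.
have hs : has_ubound (range u) by exists (v 0) => _ [m _ <-].
exists (sup (range u)) => n; apply/andP; split.
  by apply: (ub_le_sup hs); exists n.
by apply: ge_sup => [|_ [m _ <-]]; first by exists (u 0), 0.
Qed.

(** Total differentiability of a function of two real variables, with partial
    derivatives [da] and [db]. *)
Definition plane_differential (A : R -> R -> R) (s t da db : R) :=
  forall e : R, 0 < e -> exists2 d : R, 0 < d &
    forall s' t', `|s' - s| < d -> `|t' - t| < d ->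
      `|A s' t' - A s t - (da * (s' - s) + db * (t' - t))|
        <= e * (`|s' - s| + `|t' - t|).

Section ClosedForm.
Context {A B PA PB : R -> R -> R} {los lot : R}
  (dPA : forall t s, los < s -> is_derive s 1 (PA t) (A s t))
  (dPB : forall s t, lot < t -> is_derive t 1 (PB s) (B s t)).

(** The integral of [A ds + B dt] along the boundary of [a, b] x [c, d]. *)
Let circ a b c d :=
  (PA c b - PA c a) - (PA d b - PA d a) + (PB b d - PB b c) - (PB a d - PB a c).

(** Near a point of differentiability, the variation of [A] between the two
    horizontal sides and that of [B] between the two vertical ones are constant
    up to a small error; the constants cancel because the two cross
    derivatives are equal. *)
Lemma circ_local (ka e : R) (zs zt al l be : R) :
  0 < ka -> 0 < e ->
  plane_differential A zs zt al l -> plane_differential B zs zt l be ->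
  exists2 d : R, 0 < d & forall a c h, los < a -> lot < c -> 0 < h ->
    h < d -> ka * h < d ->
    a <= zs <= a + ka * h -> c <= zt <= c + h ->
    `|circ a (a + ka * h) c (c + h)| <= e * h ^+ 2.
Proof.
move=> ka0 e0 dA dB.
pose k := 2 * (ka + 1) ^+ 2; have k0 : 0 < k by rewrite mulr_gt0 // exprn_gt0 // addr_gt0.
have ek : 0 < e / k by rewrite divr_gt0.
have [d1 d10 Ad] := dA _ ek; have [d2 d20 Bd] := dB _ ek.
exists (Num.min d1 d2); first by rewrite lt_min d10.
move=> a c h loa loc h0; rewrite !lt_min => /andP[h1 h2] /andP[kh1 kh2] zsI ztI.
have kah0 : 0 < ka * h by rewrite mulr_gt0.
have near_s s : s \in `[a, a + ka * h] -> `|s - zs| <= ka * h.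
  by rewrite in_itv /= ler_norml => /andP[? ?]; case/andP: zsI => ? ?; lra.
have near_t t : t \in `[c, c + h] -> `|t - zt| <= h.
  by rewrite in_itv /= ler_norml => /andP[? ?]; case/andP: ztI => ? ?; lra.
have ci : c \in `[c, c + h] by rewrite in_itv /= lexx lerDl ltW.
have chi : c + h \in `[c, c + h] by rewrite in_itv /= lexx lerDl ltW.
have ai : a \in `[a, a + ka * h] by rewrite in_itv /= lexx lerDl ltW.
have ahi : a + ka * h \in `[a, a + ka * h] by rewrite in_itv /= lexx lerDl ltW.
pose E := e / k * (ka * h + h).
have AE s t : s \in `[a, a + ka * h] -> t \in `[c, c + h] ->
    `|A s t - A zs zt - (al * (s - zs) + l * (t - zt))| <= E.
  move=> si ti; apply: (le_trans (Ad _ _ _ _)).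
  - exact: le_lt_trans (near_s _ si) _.
  - exact: le_lt_trans (near_t _ ti) _.
  - by apply: ler_wpM2l; [exact: ltW|apply: lerD; [exact: near_s|exact: near_t]].
have BE s t : s \in `[a, a + ka * h] -> t \in `[c, c + h] ->
    `|B s t - B zs zt - (l * (s - zs) + be * (t - zt))| <= E.
  move=> si ti; apply: (le_trans (Bd _ _ _ _)).
  - exact: le_lt_trans (near_s _ si) _.
  - exact: le_lt_trans (near_t _ ti) _.
  - by apply: ler_wpM2l; [exact: ltW|apply: lerD; [exact: near_s|exact: near_t]].
have HA : `|(PA c - PA (c + h)) (a + ka * h) - (PA c - PA (c + h)) a
            - (- (l * h)) * (a + ka * h - a)| <= (E + E) * (a + ka * h - a).
  apply: (@mean_value_bound _ (fun s => A s c - A s (c + h))).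
  - by rewrite lerDl ltW.
  - move=> s; rewrite in_itv /= => /andP[as_ _].
    by apply: is_deriveB; apply: dPA; apply: lt_le_trans as_.
  - move=> s si; have H1 := AE s c si ci; have H2 := AE s _ si chi.
    move: H1 H2; rewrite !ler_norml => /andP[? ?] /andP[? ?]; lra.
have HB : `|(PB (a + ka * h) - PB a) (c + h) - (PB (a + ka * h) - PB a) c
            - (l * (ka * h)) * (c + h - c)| <= (E + E) * (c + h - c).
  apply: (@mean_value_bound _ (fun t => B (a + ka * h) t - B a t)).
  - by rewrite lerDl ltW.
  - move=> t; rewrite in_itv /= => /andP[at_ _].
    by apply: is_deriveB; apply: dPB; apply: lt_le_trans at_.
  - move=> t ti; have H1 := BE _ t ahi ti; have H2 := BE a t ai ti.
    move: H1 H2; rewrite !ler_norml => /andP[? ?] /andP[? ?]; lra.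
have -> : e * h ^+ 2 = (E + E) * (a + ka * h - a) + (E + E) * (c + h - c).
  rewrite /E /k; field; rewrite gt_eqF ?addr_gt0 //.
apply: le_trans (lerD HA HB); apply: le_trans (ler_normD _ _).
by rewrite le_eqVlt; apply/orP; left; apply/eqP; congr (`|_|); rewrite /circ !fctE /=; ring.
Qed.

(** Goursat: if the integral did not vanish, bisection would produce rectangles
    of a fixed shape, shrinking to a point, on which it is at least a fixed
    multiple of the area. This contradicts [circ_local] at that point. *)
Lemma closed_form_rect (a b c d : R) : a < b -> c < d -> los < a -> lot < c ->
  (forall s t, s \in `[a, b] -> t \in `[c, d] -> exists al l be,
     plane_differential A s t al l /\ plane_differential B s t l be) ->
  circ a b c d = 0.
Proof.
move=> ab cd loa loc dAB.
pose h0 := d - c; have h00 : 0 < h0 by rewrite subr_gt0.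
pose ka := (b - a) / h0; have ka0 : 0 < ka by rewrite divr_gt0 ?subr_gt0.
have bE : b = a + ka * h0 by rewrite /ka divfK ?gt_eqF // addrC subrK.
have dE : d = c + h0 by rewrite addrC subrK.
apply/eqP/negP => /negP circ0.
(* any constant below the ratio of the integral to the squared height works *)
pose e := `|circ a b c d| / (2 * h0 ^+ 2).
have e0 : 0 < e by rewrite divr_gt0 ?normr_gt0 // mulr_gt0 // exprn_gt0.
pose bad (u : R * R) h := e * h ^+ 2 < `|circ u.1 (u.1 + ka * h) u.2 (u.2 + h)|.
have bad0 : bad (a, c) h0.
  rewrite /bad /= -bE -dE.
  have -> : e * h0 ^+ 2 = `|circ a b c d| / 2 by rewrite /e; field; rewrite gt_eqF.
  by rewrite ltr_pdivrMr // ltr_pMr ?normr_gt0 // ltr1n.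
have step h u : exists v : R * R, 0 < h -> bad u h ->
    [/\ bad v (h / 2), u.1 <= v.1, v.1 + ka * (h / 2) <= u.1 + ka * h,
        u.2 <= v.2 & v.2 + h / 2 <= u.2 + h].
  case: (pselect (0 < h /\ bad u h)) => [[hp bu]|nb]; last by exists u => ? ?; case: nb.
  case: u bu => x y; rewrite /bad /=; set h' := h / 2.
  have hE : h = h' + h' by rewrite /h'; field.
  have h'0 : 0 < h' by rewrite divr_gt0.
  have kh'0 : 0 < ka * h' by rewrite mulr_gt0.
  have -> : x + ka * h = x + ka * h' + ka * h' by rewrite hE; ring.
  have -> : y + h = y + h' + h' by rewrite hE; ring.
  have -> : e * h ^+ 2 = e * h' ^+ 2 + e * h' ^+ 2 + e * h' ^+ 2 + e * h' ^+ 2.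
    by rewrite hE; ring.
  set x' := x + ka * h'; set y' := y + h' => bu.
  have [b1|b1] := ltP (e * h' ^+ 2) `|circ x x' y y'|.
    exists (x, y) => _ _; split=> //=; rewrite /x' /y'; lra.
  have [b2|b2] := ltP (e * h' ^+ 2) `|circ x' (x' + ka * h') y y'|.
    exists (x', y) => _ _; split=> //=; rewrite /x' /y'; lra.
  have [b3|b3] := ltP (e * h' ^+ 2) `|circ x x' y' (y' + h')|.
    exists (x, y') => _ _; split=> //=; rewrite /x' /y'; lra.
  have [b4|b4] := ltP (e * h' ^+ 2) `|circ x' (x' + ka * h') y' (y' + h')|.
    exists (x', y') => _ _; split=> //=; rewrite /x' /y'; lra.
  exfalso; move: bu; rewrite ltNge => /negP; apply.
  apply: le_trans (lerD (lerD (lerD b1 b2) b3) b4).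
  apply: le_trans (lerD (lerD (ler_normD _ _) (lexx _)) (lexx _)).
  apply: le_trans (lerD (ler_normD _ _) (lexx _)).
  apply: le_trans (ler_normD _ _).
  by rewrite le_eqVlt; apply/orP; left; apply/eqP; congr (`|_|); rewrite /circ; ring.
pose hh n := h0 / 2 ^+ n.
have hh0 n : 0 < hh n by rewrite divr_gt0 // exprn_gt0.
have hhS n : hh n.+1 = hh n / 2 by rewrite /hh exprSr invfM mulrA.
have [nxt nxtP] := choice (fun q : R * (R * R) => step q.1 q.2).
pose q := fix q n : R * R := if n is m.+1 then nxt (hh m, q m) else (a, c).
have qbad n : bad (q n) (hh n).
  elim: n => [|n IH]; first by rewrite /hh expr0 divr1.
  by rewrite hhS /=; have [] := nxtP (hh n, q n) (hh0 n) IH.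
have qS n : [/\ (q n).1 <= (q n.+1).1,
    (q n.+1).1 + ka * hh n.+1 <= (q n).1 + ka * hh n,
    (q n).2 <= (q n.+1).2 & (q n.+1).2 + hh n.+1 <= (q n).2 + hh n].
  by rewrite hhS /=; have [] := nxtP (hh n, q n) (hh0 n) (qbad n).
have [zs zsP] : exists z, forall n, (q n).1 <= z <= (q n).1 + ka * hh n.
  apply: nested_intervals => n; try by have [] := qS n.
  by rewrite lerDl mulr_ge0 // ltW.
have [zt ztP] : exists z, forall n, (q n).2 <= z <= (q n).2 + hh n.
  apply: nested_intervals => n; try by have [] := qS n.
  by rewrite lerDl ltW.
have hhE : hh 0 = h0 by rewrite /hh expr0 divr1.
have zsI : zs \in `[a, b] by rewrite in_itv /= bE -hhE; exact: (zsP 0).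
have ztI : zt \in `[c, d] by rewrite in_itv /= dE -hhE; exact: (ztP 0).
have [al [l [be [dA dB]]]] := dAB _ _ zsI ztI.
have [dl dl0 H] := circ_local ka0 e0 dA dB.
have lq n : los < (q n).1 /\ lot < (q n).2.
  elim: n => [//|n [IH1 IH2]]; have [H1 _ H2 _] := qS n.
  by split; [apply: lt_le_trans H1|apply: lt_le_trans H2].
have [n hn] : exists n, hh n < dl / (ka + 1).
  have x0 : 0 < h0 * (ka + 1) / dl by rewrite divr_gt0 // mulr_gt0 // addr_gt0.
  exists (Num.bound (h0 * (ka + 1) / dl)); rewrite /hh.
  set N := Num.bound _.
  have XN : h0 * (ka + 1) / dl < 2 ^+ N.
    apply: (lt_le_trans (archi_boundP (ltW x0))).
    by rewrite -natrX ler_nat ltnW // ltn_expl.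
  have -> : h0 = (h0 * (ka + 1) / dl) * (dl / (ka + 1)).
    by field; rewrite !gt_eqF ?addr_gt0.
  rewrite ltr_pdivrMr ?exprn_gt0 // [ltRHS]mulrC.
  by rewrite ltr_pM2r // divr_gt0 // addr_gt0.
have hn' : hh n * (ka + 1) < dl by rewrite -ltr_pdivlMr ?addr_gt0.
have [lq1 lq2] := lq n.
have hn1 : hh n < dl.
  by apply: le_lt_trans hn'; rewrite ler_peMr ?(ltW (hh0 n)) // lerDr ltW.
have hn2 : ka * hh n < dl.
  by apply: le_lt_trans hn'; rewrite mulrC ler_pM2l // lerDl.
have := H _ _ _ lq1 lq2 (hh0 n) hn1 hn2 (zsP n) (ztP n).
by rewrite leNgt => /negP; apply; exact: qbad.
Qed.

End ClosedForm.
End Goursat.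

(** * The complex exponential and the maximum principle *)

Section ComplexExponential.
Context {R : realType}.
Implicit Types (z w : R[i]).

Definition cexp w : R[i] :=
  (expR (Re w) * cos (Im w)) +i* (expR (Re w) * sin (Im w)).

Lemma cexpD z w : cexp (z + w) = cexp z * cexp w.
Proof.
case: z w => [a b] [c d]; rewrite /cexp /= expRD cosD sinD.
by apply/eqP; rewrite eq_complex /=; apply/andP; split; apply/eqP; ring.
Qed.

Lemma cexp0 : cexp 0 = 1.
Proof. by rewrite /cexp /= expR0 cos0 sin0 mul1r mul1r. Qed.

Lemma normc_cexp w : normc (cexp w) = expR (Re w).
Proof.
case: w => a b; rewrite /cexp /= !exprMn -mulrDr cos2Dsin2 mulr1 sqrtr_sqr.
by rewrite ger0_norm // expR_ge0.
Qed.

Lemma cexp_neq0 w : cexp w != 0.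
Proof. by rewrite -normc_gt0 normc_cexp expR_gt0. Qed.

Lemma cexpN w : cexp (- w) = (cexp w)^-1.
Proof.
by apply: (mulfI (cexp_neq0 w)); rewrite -cexpD subrr cexp0 divff // cexp_neq0.
Qed.

Lemma cexpMn w n : cexp (w *+ n) = cexp w ^+ n.
Proof.
elim: n => [|n IH]; first by rewrite mulr0n cexp0 expr0.
by rewrite mulrS cexpD IH exprS.
Qed.

Lemma cexp_2pi : cexp (0 +i* (pi *+ 2)) = 1.
Proof. by rewrite /cexp /= expR0 cos2pi sin2pi mul1r mulr0. Qed.

Lemma cexp_surj z : z != 0 -> exists2 w, cexp w = z & `|Im w| <= pi.
Proof.
case: z => a b z0; set r := normc (a +i* b).
have r0 : 0 < r by rewrite normc_gt0.
have r2 : r ^+ 2 = a ^+ 2 + b ^+ 2 by rewrite sqr_sqrtr // addr_ge0 ?sqr_ge0.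
have ab1 : (a / r) ^+ 2 + (b / r) ^+ 2 = 1.
  by rewrite !expr_div_n -mulrDl -r2 divff // expf_neq0 // gt_eqF.
have ar : -1 <= a / r <= 1.
  rewrite -ler_norml -(@ler_pXn2r _ 2) ?nnegrE // real_normK ?num_real // expr1n.
  by rewrite -ab1 lerDl sqr_ge0.
have [phi0 phiP] : 0 <= acos (a / r) <= pi /\ cos (acos (a / r)) = a / r.
  exact: acos_def.
have ss : sin (acos (a / r)) = `|b / r|.
  rewrite sin_acos //; have -> : 1 - (a / r) ^+ 2 = (b / r) ^+ 2.
    by apply/eqP; rewrite subr_eq addrC ab1.
  exact: sqrtr_sqr.
have [/andP[p0 p1]] := (phi0, erefl true).
have [b0|b0] := leP 0 b.
  exists ((ln r) +i* (acos (a / r))); last by rewrite /= ger0_norm.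
  rewrite /cexp /= lnK ?posrE // phiP ss ger0_norm ?divr_ge0 // ?(ltW r0) //.
  by rewrite !(mulrC r) !divfK // gt_eqF.
exists ((ln r) +i* (- acos (a / r))); last by rewrite /= normrN ger0_norm.
rewrite /cexp /= lnK ?posrE // cosN sinN phiP ss ltr0_norm; last first.
  by rewrite pmulr_llt0 // invr_gt0.
by rewrite opprK !(mulrC r) !divfK // gt_eqF.
Qed.

Lemma cexp_slope0 (e : R) : 0 < e -> exists2 d : R, 0 < d &
  forall w, normc w < d -> normc (cexp w - 1 - w) <= e * normc w.
Proof.
move=> e0; pose k := Num.min (e / 6) 1.
have k0 : 0 < k by rewrite lt_min ltr01 divr_gt0.
have ke : k <= e / 6 by rewrite ge_min lexx.
have k1 : k <= 1 by rewrite ge_min lexx orbT.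
have der (f : R -> R) (l : R) : is_derive (0 : R) 1 f l -> exists2 d : R, 0 < d &
    forall s, `|s| < d -> `|f s - f 0 - l * s| <= k * `|s|.
  move=> /is_derive1_caratheodory[g [fE cg gl]].
  have /cg/nbhs_ballP[d d0 dP] : nbhs (g 0) (ball (g 0) k).
    by apply: nbhsx_ballx.
  exists d => // s sd; have /dP : ball (0 : R) d s by rewrite /ball /= sub0r normrN.
  rewrite /= /ball /= gl distrC => /ltW H.
  by rewrite fE subr0 -mulrBl normrM ler_wpM2r.
have [d1 d10 D1] := der _ _ (is_derive_expR 0).
have [d2 d20 D2] := der _ _ (is_derive_cos 0).
have [d3 d30 D3] := der _ _ (is_derive_sin 0).
exists (Num.min (Num.min d1 (Num.min d2 d3)) (k / 2)).
  by rewrite !lt_min d10 d20 d30 divr_gt0.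
move=> w; rewrite !lt_min => /andP[/and3P[w1 w2 w3] w4].
have sw : `|Re w| <= normc w := Re_le_normc w.
have tw : `|Im w| <= normc w := Im_le_normc w.
have := D1 (Re w) (le_lt_trans sw w1).
have := D2 (Im w) (le_lt_trans tw w2).
have := D3 (Im w) (le_lt_trans tw w3).
rewrite expR0 cos0 sin0 oppr0 !mul0r !subr0 !mul1r addr0.
move: sw tw w4; set E := expR (Re w); set c := cos _; set d := sin _.
set N := normc w; move=> sw tw w4 Dd Dc De.
have N0 : 0 <= N := normc_ge0 w.
have E2 : `|E - 1| <= 2 * N.
  have -> : E - 1 = (E - 1 - Re w) + Re w by ring.
  apply: (le_trans (ler_normD _ _)).
  have : k * `|Re w| <= `|Re w| by rewrite ler_piMl.
  lra.
have E0 : `|E| <= 2.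
  have -> : E = (E - 1) + 1 by ring.
  apply: (le_trans (ler_normD _ _)); rewrite normr1; lra.
have kN (x : R) : `|x| <= N -> k * `|x| <= k * N by move=> ?; rewrite ler_pM2l.
have Ek (x y : R) : `|y| <= N -> `|x| <= k * `|y| -> `|E * x| <= 2 * (k * N).
  by move=> yN xy; rewrite normrM ler_pM // (le_trans xy) // kN.
have HR : `|E * c - 1 - Re w| <= 3 * (k * N).
  have -> : E * c - 1 - Re w = (E - 1 - Re w) + E * (c - 1) by ring.
  apply: (le_trans (ler_normD _ _)).
  have := kN _ sw; have := Ek _ _ tw Dc; lra.
have HI : `|E * d - Im w| <= 3 * (k * N).
  have -> : E * d - Im w = E * (d - Im w) + (E - 1) * Im w by ring.
  apply: (le_trans (ler_normD _ _)).
  have H1 := Ek _ _ tw Dd.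
  have H2 : `|(E - 1) * Im w| <= k * N.
    rewrite normrM; apply: (@le_trans _ _ (k * `|Im w|)); last exact: kN.
    rewrite ler_wpM2r //; lra.
  lra.
apply: (le_trans (normc_le_ReIm _)).
have -> : Re (cexp w - 1 - w) = E * c - 1 - Re w.
  by rewrite /E /c; case: (w).
have -> : Im (cexp w - 1 - w) = E * d - Im w.
  by rewrite /E /d; case: (w) => ? ? /=; rewrite oppr0 addr0.
have : (k * 6) * N <= e * N by rewrite ler_wpM2r // -ler_pdivlMr.
lra.
Qed.

Lemma slope_subE (F : fieldType) (k a u : F) : u != 0 ->
  k * ((a - 1) / u) - k = k * ((a - 1 - u) / u).
Proof. by move=> u0; field. Qed.

Lemma cderiv_cexp z : cderiv cexp z (cexp z).
Proof.
exists (fun w => if w == z then cexp z else cexp z * ((cexp (w - z) - 1) / (w - z))).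
split; last by rewrite eqxx.
  move=> w; case: eqVneq => [->|wz]; first by rewrite !subrr mulr0.
  rewrite -mulrA divfK ?subr_eq0 // mulrBr mulr1 -cexpD.
  by rewrite [z + _]addrC subrK.
apply/cont_normcP => e e0; rewrite eqxx.
have n0 : 0 < normc (cexp z) by rewrite normc_gt0 cexp_neq0.
have e1 : 0 < e / 2 / normc (cexp z) by rewrite !divr_gt0.
have [d d0 H] := cexp_slope0 e1; exists d => // w wd.
case: eqVneq => [_|wz]; first by rewrite subrr normc0.
have nwz : 0 < normc (w - z) by rewrite normc_gt0 subr_eq0.
have -> : cexp z * ((cexp (w - z) - 1) / (w - z)) - cexp z
   = cexp z * ((cexp (w - z) - 1 - (w - z)) / (w - z)).
  by rewrite slope_subE // subr_eq0.
rewrite !normcM normcV; apply: (@le_lt_trans _ _ (e / 2)); last lra.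
rewrite mulrC -ler_pdivlMr // ler_pdivrMr //; exact: H.
Qed.

Lemma ccont_cexp z : ccont cexp z.
Proof. exact: cderiv_cont (cderiv_cexp z). Qed.

End ComplexExponential.

Section MaximumPrinciple.
Context {R : realType}.
Implicit Types (z w : R[i]).

Let ReB z w : Re (z - w) = Re z - Re w.
Proof. by case: z; case: w. Qed.

Let ImB z w : Im (z - w) = Im z - Im w.
Proof. by case: z; case: w. Qed.

(** The Cauchy-Riemann equations, in the form that makes
    [Im G ds + Re G dt] a closed form. *)
Lemma cderiv_plane (G : R[i] -> R[i]) (s t : R) l : cderiv G (s +i* t) l ->
  exists al l' be,
    plane_differential (fun s t => Im (G (s +i* t))) s t al l' /\
    plane_differential (fun s t => Re (G (s +i* t))) s t l' be.
Proof.
case=> phi [GE /cont_normcP cphi phil].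
have main (e : R) : 0 < e -> exists2 d : R, 0 < d & forall s' t' : R,
    `|s' - s| < d -> `|t' - t| < d ->
    normc (G (s' +i* t') - G (s +i* t) - l * ((s' - s) +i* (t' - t)))
      <= e * (`|s' - s| + `|t' - t|).
  move=> e0; have [d d0 H] := cphi e e0.
  exists (d / 2); first by rewrite divr_gt0.
  move=> s' t' sd td.
  have wE : (s' +i* t') - (s +i* t) = (s' - s) +i* (t' - t) by [].
  have wN : normc ((s' - s) +i* (t' - t)) <= `|s' - s| + `|t' - t|.
    exact: (normc_le_ReIm ((s' - s) +i* (t' - t))).
  rewrite GE wE -mulrBl normcM -phil; apply: ler_pM => //; try exact: normc_ge0.
  apply/ltW/H; rewrite wE; apply: le_lt_trans wN _; lra.
case: l {phil} main => l1 l2 main; exists l2, l1, (- l2).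
split=> e /main[d d0 H]; exists d => // s' t' sd td; apply: le_trans (H _ _ sd td).
  apply: le_trans (Im_le_normc _).
  case: (G (s' +i* t')) => a b; case: (G (s +i* t)) => a' b' /=.
  by rewrite le_eqVlt; apply/orP; left; apply/eqP; congr (`|_|); ring.
apply: le_trans (Re_le_normc _).
case: (G (s' +i* t')) => a b; case: (G (s +i* t)) => a' b' /=.
by rewrite le_eqVlt; apply/orP; left; apply/eqP; congr (`|_|); ring.
Qed.

Lemma ccont_lines (G : R[i] -> R[i]) : (forall w, ccont G w) ->
  [/\ forall t, continuous (fun s => Im (G (s +i* t)))
    & forall s, continuous (fun t => Re (G (s +i* t)))].
Proof.
move=> cG; split=> [t s|s t] A /nbhs_ballP[e e0 eA];
  have /cont_normcP/(_ e e0)[d d0 H] := cG (s +i* t);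
  apply/nbhs_ballP; exists d => // u ud; apply: eA;
  rewrite /ball /= distrC; apply: le_lt_trans (H (_ +i* _) _).
- by rewrite -ImB; exact: Im_le_normc.
- by rewrite /= subrr expr0n addr0 sqrtr_sqr distrC.
- by rewrite -ReB; exact: Re_le_normc.
- by rewrite /= subrr expr0n add0r sqrtr_sqr distrC.
Qed.

(** In the coordinate [s + i t = log (w - w0)] the function is periodic in [t],
    so by Goursat its mean over a period does not depend on [s]; letting [s]
    tend to minus infinity, the mean is [H w0]. A mean that reaches the maximum
    forces equality everywhere. *)
Lemma local_maximum_const (H : R[i] -> R[i]) (w0 : R[i]) (r : R) :
  (forall w, ccont H w) ->
  (forall w, w != w0 -> normc (w - w0) < r -> exists l, cderiv H w l) ->
  (forall w, normc (w - w0) < r -> Re (H w) <= Re (H w0)) ->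
  forall w, normc (w - w0) < r -> Re (H w) = Re (H w0).
Proof.
move=> cH dH mH w wr; case: (eqVneq w w0) => [->//|ww0].
have r0 : 0 < r := le_lt_trans (normc_ge0 _) wr.
have [u uE _] : exists2 u, cexp u = w - w0 & `|Im u| <= pi.
  by apply: cexp_surj; rewrite subr_eq0.
case: u uE => s1 t1 uE.
have s1r : s1 < ln r.
  by rewrite -ltr_expR lnK ?posrE // -[s1]/(Re (s1 +i* t1)) -normc_cexp uE.
pose G v := H (w0 + cexp v).
have cG v : ccont G v.
  apply: (@ccont_comp _ H (fun v => w0 + cexp v)); last exact: cH.
  by apply: ccontD; [exact: ccont_cst|exact: ccont_cexp].
have Gin v : Re v < ln r -> normc (w0 + cexp v - w0) < r.
  by move=> vr; rewrite addrAC subrr add0r normc_cexp -(lnK (r0 : r \is Num.pos)) ltr_expR.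
have dG v : Re v < ln r -> exists l, cderiv G v l.
  move=> vr; have [|l dl] := dH (w0 + cexp v) _ (Gin _ vr).
    by rewrite -subr_eq0 addrAC subrr add0r cexp_neq0.
  have dE := cderivD (cderiv_cst w0 v) (cderiv_cexp v).
  exact: ex_intro _ _ (cderiv_comp dE dl).
have Gper s t : G (s +i* (t + pi *+ 2)) = G (s +i* t).
  rewrite /G; congr (H (_ + _)).
  by rewrite /cexp /= cosD2pi sinD2pi.
have [cA cB] := ccont_lines cG.
pose A s t := Im (G (s +i* t)); pose B s t := Re (G (s +i* t)).
have pi0 : 0 < pi :> R := pi_gt0 R.
(* the period is centred at [t1], which is thus an interior point *)
pose c := t1 - pi; pose d := t1 + pi.
have dcE : d = c + pi *+ 2 by rewrite /d /c mulr2n; ring.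
have cd : c < d by rewrite dcE ltrDl mulrn_wgt0.
pose lot := c - 1; pose M := Re (H w0).
have lotc : lot < c by rewrite /lot; lra.
pose PB s := primitive_from lot (B s).
have dPB s t : lot < t -> is_derive t 1 (PB s) (B s t).
  by move=> tl; apply: primitive_fromP => //; exact: cB.
have BM s t : s < ln r -> B s t <= M by move=> sr; apply/mH/Gin.
have meanE s0 : s0 < s1 -> PB s1 d - PB s1 c = PB s0 d - PB s0 c.
  move=> s01; pose los := s0 - 1; have loss : los < s0 by rewrite /los; lra.
  pose PA t := primitive_from los (fun s => A s t).
  have dPA t s : los < s -> is_derive s 1 (PA t) (A s t).
    by move=> sl; apply: (@primitive_fromP _ _ (fun s => A s t)) => //; exact: cA.
  have := @closed_form_rect R A B PA PB los lot dPA dPB s0 s1 c d s01 cd loss lotc.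
  have -> : PA d = PA c.
    by rewrite /PA; congr primitive_from; apply/funext => s; rewrite /A dcE Gper.
  rewrite subrr add0r => /(_ _)/eqP; rewrite subr_eq0 => /(_ _)/eqP; apply.
  move=> s t; rewrite !in_itv /= => /andP[_ ss1] _.
  have [|l dl] := dG (s +i* t); first by rewrite /= (le_lt_trans ss1).
  exact: cderiv_plane dl.
have bE s k K : (forall t, `|B s t - k| <= K) ->
    `|PB s d - PB s c - k * (d - c)| <= K * (d - c).
  move=> H1; apply: (@mean_value_bound _ (PB s) (B s)) => [||x _]; [exact: ltW| |exact: H1].
  by move=> x; rewrite in_itv /= => /andP[cx _]; apply: dPB; apply: lt_le_trans cx.
have meanM : PB s1 d - PB s1 c = M * (d - c).
  apply/eqP; rewrite -subr_eq0 -normr_le0; apply/ler_addgt0Pl => e e0; rewrite addr0.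
  have e1 : 0 < e / (d - c) by rewrite divr_gt0 // subr_gt0.
  have /cont_normcP/(_ _ e1)[dl dl0 Hd] := cH w0.
  pose s0 := Num.min (s1 - 1) (ln (dl / 2)).
  have s01 : s0 < s1 by rewrite /s0 gt_min; apply/orP; left; lra.
  rewrite (meanE _ s01); apply: (le_trans (bE s0 M (e / (d - c)) _)); last first.
    by rewrite divfK // gt_eqF // subr_gt0.
  move=> t; have : normc (G (s0 +i* t) - H w0) < e / (d - c).
    apply: Hd; rewrite addrAC subrr add0r normc_cexp /=.
    apply: (@le_lt_trans _ _ (dl / 2)); last lra.
    by rewrite -[leRHS]lnK ?posrE ?divr_gt0 // ler_expR /s0 ge_min lexx orbT.
  move=> /ltW; apply: le_trans; rewrite /B /M.
  by rewrite -ReB; exact: Re_le_normc.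
have wE : w = w0 + cexp (s1 +i* t1) by rewrite uE addrC subrK.
rewrite wE; apply/eqP; rewrite eq_le BM //= leNgt; apply/negP => Blt.
have fE t : t \in `[c, d] -> is_derive t 1 (fun t => M * t - PB s1 t) (M - B s1 t).
  rewrite in_itv /= => /andP[ct _]; apply: is_deriveB.
    by apply: is_derive_eq; rewrite /GRing.scale /= mulr1.
  by apply: dPB; apply: lt_le_trans ct.
have fm x y : c <= x -> x <= y -> y <= d -> M * x - PB s1 x <= M * y - PB s1 y.
  move=> cx xy yd; rewrite -subr_ge0.
  have fxy (z : R) : z \in `[x, y] -> is_derive z 1 (fun t => M * t - PB s1 t) (M - B s1 z).
    rewrite in_itv /= => /andP[xz zy]; apply: fE.
    by rewrite in_itv /= (le_trans cx xz) (le_trans zy yd).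
  have [z _ fz] := @mean_value R (fun t => M * t - PB s1 t) (fun t => M - B s1 t) x y xy fxy.
  by rewrite fz mulr_ge0 // subr_ge0 // BM.
have fcd : M * c - PB s1 c = M * d - PB s1 d.
  by apply/eqP; rewrite -subr_eq0; apply/eqP; move: meanM; rewrite mulrBr; lra.
have [ct td] : c < t1 /\ t1 < d by rewrite /c /d; split; lra.
have dt1 : is_derive t1 1 (fun t => M * t - PB s1 t) 0.
  apply: (@derive1_at_max _ _ c d); first exact: ltW.
  - move=> t /subset_itv_oo_cc tI; exact: (@ex_derive _ _ _ _ _ _ _ (fE t tI)).
  - by rewrite in_itv /= ct.
  - move=> t; rewrite in_itv /= => /andP[/ltW ct' /ltW td'].
    apply: le_trans (fm c t1 (lexx _) (ltW ct) (ltW td)).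
    by rewrite fcd fm.
have tI : t1 \in `[c, d] by rewrite in_itv /= (ltW ct) (ltW td).
have := @derive_val _ _ _ _ _ _ _ (fE t1 tI).
rewrite (@derive_val _ _ _ _ _ _ _ dt1) => /esym/eqP; rewrite subr_eq0 => /eqP ME.
by move: Blt; rewrite -[X in _ < X]/M ME /B /G ltxx.
Qed.

End MaximumPrinciple.

(** * Doubly periodic functions *)

Section Liouville.
Context {R : realType}.
Implicit Types (z w : R[i]) (f g : R[i] -> R[i]).

Lemma ccont_local f g z (d : R) : 0 < d ->
  (forall w, normc (w - z) < d -> f w = g w) -> ccont g z -> ccont f z.
Proof.
move=> d0 fg /cont_normcP cg; apply/cont_normcP => e /cg[d' d'0 H].
exists (Num.min d d'); first by rewrite lt_min d0.
move=> w; rewrite lt_min => /andP[wd wd'].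
have -> : f z = g z by apply: fg; rewrite subrr normc0.
by rewrite fg //; exact: H.
Qed.

Lemma cderiv_local f g z l (d : R) : 0 < d ->
  (forall w, normc (w - z) < d -> f w = g w) -> cderiv g z l -> cderiv f z l.
Proof.
move=> d0 fg dg; case: (dg) => phi [gE cphi phil].
exists (fun w => if normc (w - z) < d then phi w else (f w - f z) / (w - z)).
have zz : normc (z - z) < d by rewrite subrr normc0.
split; last by rewrite zz.
  move=> w; case: ifPn => [wd|]; first by rewrite (fg _ wd) (fg _ zz); exact: gE.
  rewrite -leNgt => wd; rewrite divfK // -normc_gt0; exact: lt_le_trans wd.
by apply: (ccont_local d0 _ cphi) => w ->.
Qed.

Lemma normc_punctured_eq f g z (d : R) : 0 < d -> ccont f z -> ccont g z ->
  (forall w, w != z -> normc (w - z) < d -> normc (f w) = normc (g w)) ->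
  normc (f z) = normc (g z).
Proof.
move=> d0 /cont_normcP cf /cont_normcP cg fg.
apply/eqP; rewrite -subr_eq0 -normr_le0; apply/ler_addgt0Pl => e e0; rewrite addr0.
have e2 : 0 < e / 2 by rewrite divr_gt0.
have [d1 d10 H1] := cf _ e2; have [d2 d20 H2] := cg _ e2.
pose h := Num.min d (Num.min d1 d2) / 2.
have h0 : 0 < h by rewrite divr_gt0 // !lt_min d0 d10.
have hh : h < Num.min d (Num.min d1 d2).
  by rewrite ltr_pdivrMr // ltr_pMr ?ltr1n // !lt_min d0 d10.
have wz : z + h%:C - z = h%:C by rewrite addrAC subrr add0r.
have hN : normc (z + h%:C - z) = h by rewrite wz normc_real gtr0_norm.
move: hh; rewrite !lt_min => /and3P[hd hd1 hd2].
have wne : z + h%:C != z by rewrite -subr_eq0 -normc_gt0 hN.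
have := fg _ wne; rewrite hN => /(_ hd) E.
have := H1 (z + h%:C); rewrite hN => /(_ hd1) F1.
have := H2 (z + h%:C); rewrite hN => /(_ hd2) F2.
have tri (a b : R[i]) : normc a <= normc (a - b) + normc b.
  by rewrite -{1}(subrK b a); exact: le_normcD.
have T1 := tri (f (z + h%:C)) (f z); have T2 := tri (f z) (f (z + h%:C)).
have T3 := tri (g (z + h%:C)) (g z); have T4 := tri (g z) (g (z + h%:C)).
rewrite normcB in T2; rewrite normcB in T4.
rewrite ler_norml; apply/andP; split; lra.
Qed.

(** The complex plane is connected: restrict the property to a line and use the
    connectedness of the real line. *)
Lemma clopen_connected (P : R[i] -> Prop) w0 :
  P w0 ->
  (forall w, P w -> exists2 d : R, 0 < d & forall w', normc (w' - w) < d -> P w') ->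
  (forall w, ~ P w -> exists2 d : R, 0 < d & forall w', normc (w' - w) < d -> ~ P w') ->
  forall w, P w.
Proof.
move=> P0 oP cP w.
pose gam (t : R) : R[i] := w0 + t%:C * (w - w0).
have gamB s t : gam s - gam t = (s - t)%:C * (w - w0).
  by rewrite /gam rmorphB mulrBl opprD addrACA subrr add0r.
have gopen (Q : R[i] -> Prop) :
    (forall w, Q w -> exists2 d : R, 0 < d & forall w', normc (w' - w) < d -> Q w') ->
    open [set t | Q (gam t)].
  move=> oQ; rewrite openE => t /= /oQ[d d0 H].
  have k0 : 0 < normc (w - w0) + 1 by rewrite ltr_wpDl // normc_ge0.
  apply/nbhs_ballP; exists (d / (normc (w - w0) + 1)); first by rewrite /= divr_gt0.
  move=> s; rewrite /ball /= ltr_pdivlMr // => st; apply: H.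
  rewrite gamB normcM normc_real; apply: le_lt_trans st.
  by rewrite distrC ler_wpM2l // lerDl.
have /connected_intervalP cR : is_interval (setT : set R) by [].
have E : [set t | P (gam t)] = setT.
  apply: cR.
  - by exists 0; rewrite /= /gam mul0r addr0.
  - by exists [set t | P (gam t)]; [exact: gopen|rewrite setTI].
  - exists [set t | P (gam t)]; last by rewrite setTI.
    rewrite -[X in closed X]setCK; apply: open_closedC.
    exact: (gopen (fun w => ~ P w)).
have : [set t | P (gam t)] 1 by rewrite E.
by rewrite /= /gam mul1r addrC subrK.
Qed.

(** The rectangle with sides [Re l] and [2 pi] meets every orbit of the lattice
    of periods, even though it is not a period parallelogram. *)
Lemma doubly_periodic_max (q : R[i] -> R[i]) (l : R[i]) :
  (forall w, ccont q w) -> 0 < Re l ->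
  (forall w, normc (q (w + l)) = normc (q w)) ->
  (forall w, normc (q (w + (0 +i* (pi *+ 2)))) = normc (q w)) ->
  exists w0, forall w, normc (q w) <= normc (q w0).
Proof.
move=> cq l0 perl perpi.
have perZ v : (forall w, normc (q (w + v)) = normc (q w)) ->
    forall (k : int) w, normc (q (w + v *~ k)) = normc (q w).
  move=> pv; have pvn (n : nat) w : normc (q (w + v *+ n)) = normc (q w).
    by elim: n => [|n IH]; [rewrite mulr0n addr0|rewrite mulrSr addrA pv IH].
  case=> n w; first exact: pvn.
  by rewrite NegzE mulrNz -pmulrn -[in RHS](subrK (v *+ n.+1) w) pvn.
pose N (u : R * R) : R := normc (q (u.1 +i* u.2)).
pose K : set (R * R) := `[0, Re l] `*` `[0, pi *+ 2].
have pi0 : 0 < pi *+ 2 :> R by rewrite mulrn_wgt0 // pi_gt0.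
have cN : continuous N.
  move=> u A /nbhs_ballP[e e0 eA].
  have /cont_normcP/(_ e e0)[d d0 H] := cq (u.1 +i* u.2).
  apply/nbhs_ballP; exists (d / 2); first by rewrite /= divr_gt0.
  move=> v [v1 v2]; apply: eA; rewrite /ball /= distrC.
  have tri (a b : R[i]) : `|normc a - normc b| <= normc (a - b).
    rewrite ler_norml; have := le_normcD (a - b) b; rewrite subrK => ?.
    have := le_normcD (b - a) a; rewrite subrK normcB => ?.
    by apply/andP; split; lra.
  apply: (le_lt_trans (tri _ _)); apply: H.
  apply: (le_lt_trans (normc_le_ReIm _)); rewrite /=.
  move: v1 v2; rewrite /ball /= (distrC u.1) (distrC u.2) => ? ?; lra.
have [c _ cmax] : exists2 c, c \in K & forall t, t \in K -> N t <= N c.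
  apply: compact_EVT_max.
  - by exists (0, 0); split; rewrite /= in_itv /= lexx ltW.
  - by apply: compact_setX; exact: segment_compact.
  - exact: continuous_subspaceT.
exists (c.1 +i* c.2) => w.
pose k := Num.floor (Re w / Re l).
pose w1 := w + l *~ (- k).
pose m := Num.floor (Im w1 / (pi *+ 2)).
pose w2 := w1 + (0 +i* (pi *+ 2)) *~ (- m).
have <- : normc (q w1) = normc (q w) by exact: perZ.
have <- : normc (q w2) = normc (q w1) by exact: perZ.
have ReZ (v : R[i]) (j : int) : Re (v *~ j) = Re v *~ j.
  exact: (raddfMz (@complex.Re R : Rcomplex R -> R)).
have ImZ (v : R[i]) (j : int) : Im (v *~ j) = Im v *~ j.
  exact: (raddfMz (@complex.Im R : Rcomplex R -> R)).
have ReD (u v : R[i]) : Re (u + v) = Re u + Re v by case: u; case: v.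
have ImD (u v : R[i]) : Im (u + v) = Im u + Im v by case: u; case: v.
have frac (a b : R) : 0 < b -> 0 <= a + b *~ (- Num.floor (a / b)) <= b.
  move=> b0; rewrite mulrNz -mulrzr.
  have := floor_le (a / b); have := lt_succ_floor (a / b).
  rewrite -(ltr_pM2r b0) -(ler_pM2r b0) divfK ?gt_eqF // intrD mulrDl mul1r => H1 H2.
  by apply/andP; split; lra.
have K2 : (Re w2, Im w2) \in K.
  rewrite inE; split; rewrite /= in_itv /=.
    by rewrite /w2 ReD ReZ mul0rz addr0 /w1 ReD ReZ; exact: frac.
  by rewrite /w2 ImD ImZ /=; exact: frac.
have := cmax _ K2; rewrite /N /=.
by case: (w2).
Qed.

End Liouville.

(** * Liouville's theorem for quotients *)

Section QuotientLiouville.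
Context {R : realType}.
Implicit Types (z w : R[i]) (f g : R[i] -> R[i]).

Lemma Re1_normc_le1 z : Re z = 1 -> normc z <= 1 -> z = 1.
Proof.
case: z => a b /= ->; rewrite -[leRHS]sqrtr1 ler_sqrt ?ltr01 // expr1n gerDl => b0.
have /eqP : b ^+ 2 = 0 by apply/eqP; rewrite eq_le b0 sqr_ge0.
by rewrite expf_eq0 /= => /eqP ->.
Qed.

(** The set where [q] takes the value [q w0] is open, by the maximum principle
    applied to [q / q w0], and closed, by continuity. *)
Lemma maximum_modulus_const (q : R[i] -> R[i]) w0 :
  (forall w, ccont q w) ->
  (forall w, exists2 d : R, 0 < d & forall w', w' != w -> normc (w' - w) < d ->
     exists l, cderiv q w' l) ->
  (forall w, normc (q w) <= normc (q w0)) -> forall w, q w = q w0.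
Proof.
move=> cq dq qmax.
have [q0|q0] := eqVneq (q w0) 0.
  move=> w; apply: etrans (esym q0); apply: eq0_normc; apply/eqP.
  by rewrite eq_le normc_ge0 andbT; have := qmax w; rewrite q0 normc0.
have n0 : 0 < normc (q w0) by rewrite normc_gt0.
apply: (@clopen_connected _ (fun w => q w = q w0) w0) => [//|w1 q1|w1 q1].
  have [d d0 dP] := dq w1; exists d => //.
  pose H w := (q w0)^-1 * q w.
  have Hw1 : H w1 = 1 by rewrite /H q1 mulVf.
  have HN w : normc (H w) <= 1.
    by rewrite normcM normcV mulrC ler_pdivrMr // mul1r.
  have cH w : ccont H w by apply: ccontM; [exact: ccont_cst|exact: cq].
  have dH w : w != w1 -> normc (w - w1) < d -> exists l, cderiv H w l.
    by move=> ww1 /(dP _ ww1)[l dl]; exists ((q w0)^-1 * l); exact: cderivZ.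
  have mH w : normc (w - w1) < d -> Re (H w) <= Re (H w1).
    move=> _; rewrite Hw1; apply: le_trans (HN w).
    by apply: le_trans (Re_le_normc _); exact: ler_norm.
  move=> w wd; have := local_maximum_const cH dH mH wd; rewrite Hw1 => R1.
  have /(congr1 (fun u => q w0 * u)) := Re1_normc_le1 R1 (HN w).
  by rewrite /H mulrA divff // mul1r mulr1.
have e0 : 0 < normc (q w1 - q w0) by rewrite normc_gt0 subr_eq0; apply/eqP.
have /cont_normcP/(_ _ e0)[d d0 H] := cq w1; exists d => // w /H wd qw.
by move: wd; rewrite qw normcB ltxx.
Qed.

Lemma slope_quotient (F : fieldType) (a b u : F) : u != 0 ->
  (a * u) / (b * u) = a / b.
Proof. by move=> u0; rewrite invfM mulrACA divff // mulr1. Qed.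

(** The quotient, extended to the common zeros by the ratio of derivatives, is
    continuous, differentiable off a discrete set, and of doubly periodic
    modulus; so its modulus has a maximum, and it is constant. *)
Theorem quotient_liouville f g (l : R[i]) : 0 < Re l ->
  (forall w, exists d, cderiv f w d) ->
  (forall w, exists2 d, cderiv g w d & g w = 0 -> d != 0 /\ f w = 0) ->
  (forall v, v = l \/ v = 0 +i* (pi *+ 2) -> forall w,
     normc (f (w + v)) * normc (g w) = normc (f w) * normc (g (w + v))) ->
  exists k, forall w, f w = k * g w.
Proof.
move=> l0 df dg per.
have [f' f'P] := choice df.
have dg' w : exists d, cderiv g w d /\ (g w = 0 -> d != 0 /\ f w = 0).
  by have [d ? ?] := dg w; exists d.
have {dg dg'} [g' g'P] := choice dg'.
pose q w := if g w == 0 then f' w / g' w else f w / g w.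
have punct w : exists2 d : R, 0 < d &
    forall w', normc (w' - w) < d -> w' != w -> g w' != 0.
  have [dgw g0] := g'P w; apply: cderiv_neq0_near dgw _.
  by case: eqVneq => [/g0[]|]; [right|left].
have cf w : ccont f w := cderiv_cont (f'P w).
have cg w : ccont g w := cderiv_cont (g'P w).1.
have gnear w : g w != 0 -> exists2 d : R, 0 < d & forall w', normc (w' - w) < d -> g w' != 0.
  move=> gw; have [d d0 H] := punct w; exists d => // w' wd.
  by have [->//|/H] := eqVneq w' w; exact.
have cq w : ccont q w.
  have [gw|gw] := eqVneq (g w) 0; last first.
    have [d d0 H] := gnear w gw.
    apply: (@ccont_local _ _ (fun w => f w * (g w)^-1) _ d d0).
      by move=> w' /H gw'; rewrite /q (negPf gw').
    by apply: ccontM; [exact: cf|exact: ccontV].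
  have [d d0 H] := punct w.
  have [[u [fE cu ul]] [v [gE cv vl]]] := (f'P w, (g'P w).1).
  have [g'0 fw] := (g'P w).2 gw.
  apply: (@ccont_local _ _ (fun w => u w * (v w)^-1) _ d d0); last first.
    apply: ccontM; first exact: cu.
    by apply: ccontV; [rewrite vl|exact: cv].
  move=> w' wd; rewrite /q; have [->|ww] := eqVneq w' w.
    by rewrite gw eqxx ul vl.
  rewrite (negPf (H _ wd ww)).
  have := fE w'; have := gE w'; rewrite fw gw !subr0 => -> ->.
  by rewrite slope_quotient // subr_eq0.
have dq w : exists2 d : R, 0 < d & forall w', w' != w -> normc (w' - w) < d ->
     exists d', cderiv q w' d'.
  have [d d0 H] := punct w; exists d => // w' ww wd.
  have gw' := H _ wd ww; have [d' d'0 H'] := gnear w' gw'.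
  have dV := cderiv_comp (g'P w').1 (cderivV gw').
  have dM := cderivM (f'P w') dV.
  eexists; apply: (cderiv_local d'0 _ dM) => u /H' gu.
  by rewrite /q (negPf gu).
have qper v : v = l \/ v = 0 +i* (pi *+ 2) -> forall w, normc (q (w + v)) = normc (q w).
  move=> vP w.
  have [d1 d10 H1] := punct w; have [d2 d20 H2] := punct (w + v).
  apply: (@normc_punctured_eq _ (fun w => q (w + v)) q w (Num.min d1 d2)).
  - by rewrite lt_min d10.
  - apply: (@ccont_comp _ q (fun w => w + v)); last exact: cq.
    by apply: ccontD; [exact: ccont_id|exact: ccont_cst].
  - exact: cq.
  move=> w' ww; rewrite lt_min => /andP[wd1 wd2].
  have gw := H1 _ wd1 ww.
  have gwv : g (w' + v) != 0.
    apply: H2; first by rewrite opprD addrACA subrr addr0.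
    by apply: contra ww => /eqP/addIr ->.
  rewrite /q (negPf gw) (negPf gwv) !normcM !normcV.
  apply/eqP; rewrite eqr_div ?normc_eq0 //; apply/eqP.
  exact: per.
have [w0 qmax] := doubly_periodic_max cq l0 (qper _ (or_introl erefl)) (qper _ (or_intror erefl)).
have qc := maximum_modulus_const cq dq qmax.
exists (q w0) => w; have := qc w; rewrite /q.
case: eqVneq => [gw _|gw <-]; last by rewrite divfK.
by rewrite gw mulr0; have [] := (g'P w).2 gw.
Qed.

End QuotientLiouville.

(** * The infinite product *)

Section GeometricConvergence.
Context {R : realType}.

(** Adding and subtracting the tail of the geometric series makes a real
    sequence monotone, so that the limit is the common point of nested
    intervals. *)
Lemma geometric_limit (u : nat -> R[i]) (K r : R) : 0 <= r < 1 ->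
  (forall n, normc (u n.+1 - u n) <= K * r ^+ n) ->
  exists l, forall n, normc (u n - l) <= 2 * K / (1 - r) * r ^+ n.
Proof.
move=> /andP[r0 r1] uK; have r1' : 0 < 1 - r by rewrite subr_gt0.
have real_case (v : nat -> R) : (forall n, `|v n.+1 - v n| <= K * r ^+ n) ->
    exists z, forall n, `|v n - z| <= K / (1 - r) * r ^+ n.
  move=> vK; pose t n := K / (1 - r) * r ^+ n.
  have tS n : t n - t n.+1 = K * r ^+ n.
    by rewrite /t exprS; field; rewrite gt_eqF.
  have t0 n : 0 <= t n.
    rewrite /t mulr_ge0 ?exprn_ge0 // divr_ge0 ?(ltW r1') //.
    by have := le_trans (normr_ge0 _) (vK 0); rewrite expr0 mulr1.
  have [z zP] : exists z, forall n, v n - t n <= z <= v n + t n.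
    apply: nested_intervals => n; have := vK n; rewrite -tS ler_norml => /andP[? ?]; try lra.
    by have := t0 n; lra.
  exists z => n; rewrite ler_norml; have /andP[? ?] := zP n.
  by apply/andP; split; rewrite -/(t n); lra.
have ReB (z w : R[i]) : Re (z - w) = Re z - Re w by case: z; case: w.
have ImB (z w : R[i]) : Im (z - w) = Im z - Im w by case: z; case: w.
have [a aP] : exists z, forall n, `|Re (u n) - z| <= K / (1 - r) * r ^+ n.
  by apply: real_case => n; rewrite -ReB; apply: le_trans (Re_le_normc _) (uK n).
have [b bP] : exists z, forall n, `|Im (u n) - z| <= K / (1 - r) * r ^+ n.
  by apply: real_case => n; rewrite -ImB; apply: le_trans (Im_le_normc _) (uK n).
exists (a +i* b) => n; apply: le_trans (normc_le_ReIm _) _.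
rewrite ReB ImB /=; apply: le_trans (lerD (aP n) (bP n)) _.
by rewrite -mulrDl -mulrDl -mulr2n mulr_natl.
Qed.

Lemma geometric_cvg (u : nat -> R[i]) (l : R[i]) (K r : R) : 0 <= r < 1 ->
  (forall n, normc (u n - l) <= K * r ^+ n) ->
  u n @[n --> \oo] --> (l : R[i]^o).
Proof.
move=> /andP[r0 r1] uK A /nbhs_normc[e e0 eA].
have /(_ r) : forall r : R, `|r| < 1 -> r ^+ n @[n --> \oo] --> 0 := @cvg_expr R.
rewrite ger0_norm // => /(_ r1) cr.
have k0 : 0 < e / (`|K| + 1) by rewrite divr_gt0 // ltr_wpDl.
have nb : nbhs (0 : R) (fun x => `|x| < e / (`|K| + 1)).
  apply/nbhs_ballP; exists (e / (`|K| + 1)); first exact: k0.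
  by move=> x; rewrite /ball /= sub0r normrN.
have [N _ NP] := cr _ nb.
exists N => // n /= Nn; apply: eA; apply: le_lt_trans (uK n) _.
have := NP n Nn; rewrite /= ger0_norm ?exprn_ge0 // ltr_pdivlMr ?ltr_wpDl // => H.
apply: le_lt_trans H; rewrite mulrC ler_wpM2l ?exprn_ge0 //.
by apply: (le_trans (ler_norm K)); rewrite lerDl.
Qed.

Lemma expr_eventually_small (q a : R[i]) (d : R) : normc q < 1 -> 0 < d ->
  exists n, normc (a * q ^+ n) < d.
Proof.
move=> q1 d0.
have q01 : 0 <= normc q < 1 by rewrite normc_ge0.
have : (fun n => a * q ^+ n) n @[n --> \oo] --> (0 : R[i]^o).
  by apply: (@geometric_cvg _ _ (normc a) _ q01) => n; rewrite subr0 normcM normcX.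
have nb : nbhs (0 : R[i]^o) (fun w => normc w < d).
  by apply: (nbhs_normc _ _).2; exists d => // w; rewrite subr0.
by move=> /(_ _ nb)[n _ /(_ n (leqnn n))] ?; exists n.
Qed.

(** The product of the [1 + rho r^j] is bounded by the exponential of the
    geometric series. *)
Lemma prod_growth_bound (x : nat -> R) (rho r : R) : 0 <= r < 1 -> 0 <= rho ->
  0 <= x 0 -> (forall n, x n.+1 <= x n * (1 + rho * r ^+ n)) ->
  forall n, x n <= x 0 * expR (rho / (1 - r)).
Proof.
move=> /andP[r0 r1] rho0 x0 xS n; have r1' : 0 < 1 - r by rewrite subr_gt0.
apply: (@le_trans _ _ (x 0 * expR (rho * (1 - r ^+ n) / (1 - r)))).
  elim: n => [|n IH]; first by rewrite expr0 subrr mulr0 mul0r expR0 mulr1.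
  have e0 : 0 <= 1 + rho * r ^+ n by rewrite addr_ge0 // mulr_ge0 // exprn_ge0.
  apply: le_trans (xS n) _; apply: le_trans (ler_wpM2r e0 IH) _.
  have -> : rho * (1 - r ^+ n.+1) / (1 - r)
      = rho * (1 - r ^+ n) / (1 - r) + rho * r ^+ n.
    by rewrite exprS; field; rewrite gt_eqF.
  rewrite expRD mulrA ler_wpM2l ?expR_ge1Dx //.
  by rewrite mulr_ge0 // expR_ge0.
rewrite ler_wpM2l // ler_expR ler_pM2r ?invr_gt0 // ler_piMr // gerBl.
exact: exprn_ge0.
Qed.

End GeometricConvergence.

Section QPochhammer.
Context {R : realType} (q : R[i]) (q1 : normc q < 1).
Implicit Types (a b z w : R[i]).

Let r := normc q.
Let r01 : 0 <= r < 1. Proof. by rewrite normc_ge0. Qed.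

Definition qprod (a : R[i]) (n : nat) : R[i] := \prod_(j < n) (1 - a * q ^+ j).

Lemma qprodS a n : qprod a n.+1 = qprod a n * (1 - a * q ^+ n).
Proof. exact: big_ord_recr. Qed.

Lemma qprodSl a n : qprod a n.+1 = (1 - a) * qprod (q * a) n.
Proof.
rewrite /qprod big_ord_recl expr0 mulr1; congr (_ * _).
by apply: eq_bigr => i _; rewrite exprSr mulrA mulrAC (mulrC a).
Qed.

Lemma normc_factor_le a (rho : R) n : normc a <= rho ->
  normc (1 - a * q ^+ n) <= 1 + rho * r ^+ n.
Proof.
move=> arho; apply: (le_trans (ler_normcB _ _)); rewrite normc1 lerD2l.
by rewrite normcM normcX ler_wpM2r // exprn_ge0 // normc_ge0.
Qed.

Lemma qprod_bound (rho : R) : 0 <= rho -> exists2 B, 0 <= B &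
  forall a n, normc a <= rho -> normc (qprod a n) <= B.
Proof.
move=> rho0; exists (1 * expR (rho / (1 - r))); first by rewrite mul1r expR_ge0.
move=> a n arho.
have x0 : 1 = normc (qprod a 0) by rewrite /qprod big_ord0 normc1.
rewrite [X in X * _]x0; apply: (@prod_growth_bound _ (fun n => normc (qprod a n)) _ _ r01 rho0).
  exact: normc_ge0.
move=> m.
by rewrite qprodS normcM ler_wpM2l ?normc_ge0 // normc_factor_le.
Qed.

(** The divided difference of the partial products: a uniform limit of these is
    a slope function for the infinite product. *)
Fixpoint qslope (a b : R[i]) (n : nat) : R[i] :=
  if n is m.+1 then qslope a b m * (1 - b * q ^+ m) - q ^+ m * qprod a m else 0.

Lemma qslope_step (F : fieldType) (A B S a b t : F) : B - A = S * (b - a) ->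
  B * (1 - b * t) - A * (1 - a * t) = (S * (1 - b * t) - t * A) * (b - a).
Proof.
move=> H; have -> : B = A + S * (b - a) by rewrite -H; ring.
by ring.
Qed.

Lemma qslopeE a b n : qprod b n - qprod a n = qslope a b n * (b - a).
Proof.
elim: n => [|n IH]; first by rewrite /qprod !big_ord0 subrr mul0r.
by rewrite !qprodS /=; exact: qslope_step.
Qed.

Lemma qslope_bound (rho : R) : 1 <= rho -> exists2 B, 0 <= B &
  forall a b n, normc a <= rho -> normc b <= rho -> normc (qslope a b n) <= B.
Proof.
move=> rho1; have rho0 : 0 <= rho by lra.
have [B B0 HB] := qprod_bound rho0.
exists ((0 + B) * expR (rho / (1 - r))); first by rewrite mulr_ge0 ?add0r ?expR_ge0.
move=> a b n arho brho.
have x0 : 0 = normc (qslope a b 0) by rewrite normc0.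
apply: (@le_trans _ _ (normc (qslope a b n) + B)); first by rewrite lerDl.
rewrite [X in (X + _) * _]x0.
apply: (@prod_growth_bound _ (fun n => normc (qslope a b n) + B) _ _ r01 rho0).
  by rewrite addr_ge0 ?normc_ge0.
move=> m; set s := qslope a b m; have rm : 0 <= r ^+ m by rewrite exprn_ge0 // normc_ge0.
rewrite [qslope a b m.+1]/=.
have H1 : normc (s * (1 - b * q ^+ m)) <= normc s * (1 + rho * r ^+ m).
  by rewrite normcM ler_wpM2l ?normc_ge0 // normc_factor_le.
have H2 : normc (q ^+ m * qprod a m) <= rho * r ^+ m * B.
  rewrite normcM normcX ler_pM ?exprn_ge0 ?normc_ge0 ?HB //.
  by rewrite ler_peMl.
apply: le_trans (lerD (ler_normcB _ _) (lexx _)) _.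
by apply: le_trans (lerD (lerD H1 H2) (lexx _)) _; rewrite mulrDl; lra.
Qed.

Lemma mulr_1sub_sub (F : fieldType) (x y : F) : x * (1 - y) - x = - (x * y).
Proof. by ring. Qed.

Lemma qprod_cvg a : qprod a n @[n --> \oo] --> (qpoch q a : R[i]^o).
Proof.
have [B B0 HB] := qprod_bound (normc_ge0 a).
have qS n : normc (qprod a n.+1 - qprod a n) <= B * normc a * r ^+ n.
  rewrite qprodS mulr_1sub_sub normcN !normcM normcX mulrA.
  rewrite ler_wpM2r ?exprn_ge0 ?normc_ge0 // ler_wpM2r ?normc_ge0 //.
  exact: HB.
have [l lP] := geometric_limit r01 qS.
have cl := geometric_cvg r01 lP.
have -> : qpoch q a = l by exact: (cvg_lim (@norm_hausdorff _ R[i]^o) cl).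
exact: cl.
Qed.

Lemma qprod_lim a (l : R[i]) : qprod a n @[n --> \oo] --> (l : R[i]^o) ->
  qpoch q a = l.
Proof.
by move=> cl; exact: (cvg_lim (@norm_hausdorff _ R[i]^o) cl).
Qed.

Lemma ccont_qslope a n z : ccont (fun b => qslope a b n) z.
Proof.
elim: n => [|n IH] /=; first exact: ccont_cst.
apply: ccontD; last exact: ccont_cst.
apply: ccontM; first exact: IH.
apply: ccontD; first exact: ccont_cst.
by apply: ccontN; apply: ccontM; [exact: ccont_id|exact: ccont_cst].
Qed.

Lemma mulr_1sub_sub_sub (F : fieldType) (x y z : F) :
  x * (1 - y) - z - x = - (x * y) - z.
Proof. by ring. Qed.

(** The divided differences of the partial products converge uniformly near
    [a], so their limit is a slope function that is continuous at [a]. *)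
Lemma cderiv_qpoch a : exists l, cderiv (qpoch q) a l.
Proof.
pose rho := normc a + 1.
have rho1 : 1 <= rho by rewrite /rho lerDr normc_ge0.
have rho0 : 0 <= rho by lra.
have arho : normc a <= rho by rewrite /rho lerDl.
have [B B0 HB] := qprod_bound rho0; have [S S0 HS] := qslope_bound rho1.
have step b n : normc b <= rho ->
    normc (qslope a b n.+1 - qslope a b n) <= (S * rho + B) * r ^+ n.
  move=> brho /=; rewrite mulr_1sub_sub_sub; apply: le_trans (ler_normcB _ _) _.
  rewrite normcN !normcM !normcX mulrDl mulrA; apply: lerD.
    rewrite ler_wpM2r ?exprn_ge0 ?normc_ge0 // ler_pM ?normc_ge0 //.
    exact: HS.
  by rewrite mulrC ler_wpM2r ?exprn_ge0 ?normc_ge0 // HB.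
pose K := 2 * (S * rho + B) / (1 - r).
have slope_lim b : exists l, normc b <= rho ->
    forall n, normc (qslope a b n - l) <= K * r ^+ n.
  have [brho|brho] := leP (normc b) rho; last by exists 0.
  by have [l lP] := geometric_limit r01 (fun n => step b n brho); exists l.
have [phi phiP] := choice slope_lim.
have near_rho b : normc (b - a) < 1 -> normc b <= rho.
  move=> /ltW ba; rewrite -(subrK a b) addrC; apply: (le_trans (le_normcD _ _)).
  by rewrite lerD2l.
have phiE b : normc (b - a) < 1 -> qpoch q b = qpoch q a + phi b * (b - a).
  move=> ba; apply: qprod_lim.
  have -> : qprod b = (fun n => qprod a n + qslope a b n * (b - a)).
    by apply/funext => n; rewrite -qslopeE addrC subrK.
  apply: (@cvgD R[i] R[i]^o); first exact: qprod_cvg.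
  apply: (@cvgM R[i]); last exact: cvg_cst.
  exact: geometric_cvg r01 (phiP b (near_rho b ba)).
have cphi : ccont phi a.
  apply/cont_normcP => e e0; have e3 : 0 < e / 3 by rewrite divr_gt0.
  have K0 : 0 <= `|K| := normr_ge0 K.
  have [n nP] := @expr_eventually_small _ q (`|K|)%:C (e / 3) q1 e3.
  have {nP} Kn : K * r ^+ n <= e / 3.
    rewrite normcM normcX normc_real normr_id in nP.
    apply: le_trans (ltW nP); rewrite ler_wpM2r ?ler_norm // exprn_ge0 //.
    exact: normc_ge0.
  have cs : ccont (fun b => qslope a b n) a by apply: ccont_qslope.
  have /cont_normcP/(_ _ e3)[d d0 H] := cs.
  exists (Num.min d 1); first by rewrite lt_min d0 ltr01.
  move=> b; rewrite lt_min => /andP[/H Hb b1].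
  have P1 := le_trans (phiP b (near_rho b b1) n) Kn.
  have P2 := le_trans (phiP a arho n) Kn.
  have -> : phi b - phi a = (qslope a a n - phi a) - (qslope a b n - phi b)
      + (qslope a b n - qslope a a n).
    by move: (qslope a a n) (qslope a b n) (phi a) (phi b) => x y z t; ring.
  apply: (le_lt_trans (le_normcD _ _)).
  have := ler_normcB (qslope a a n - phi a) (qslope a b n - phi b); lra.
exists (phi a).
apply: (@cderiv_local _ _ (fun b => qpoch q a + phi b * (b - a)) _ _ 1 ltr01 phiE).
exists phi; split => // w.
by rewrite subrr mulr0 addr0 addrC addKr.
Qed.

Lemma ccont_qpoch a : ccont (qpoch q) a.
Proof. by have [l /cderiv_cont] := cderiv_qpoch a. Qed.

Lemma qpochS a : qpoch q a = (1 - a) * qpoch q (q * a).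
Proof.
apply: qprod_lim.
have H : qprod a n.+1 @[n --> \oo] --> ((1 - a) * qpoch q (q * a) : R[i]^o).
  have -> : (fun n => qprod a n.+1) = (fun n => (1 - a) * qprod (q * a) n).
    by apply/funext => n; exact: qprodSl.
  by apply: (@cvgM R[i]); [exact: cvg_cst|exact: qprod_cvg].
by move: H; rewrite (@cvg_shiftS R[i]^o (qprod a)).
Qed.

Lemma qpoch0 : qpoch q 0 = 1.
Proof.
apply: qprod_lim; have -> : qprod 0 = fun=> 1.
  apply/funext => n; rewrite /qprod big1 // => i _.
  by rewrite mul0r subr0.
by apply: (@geometric_cvg _ _ _ 0 _ r01) => n; rewrite subrr normc0 mul0r.
Qed.

Lemma qpoch_split a n : qpoch q a = qprod a n * qpoch q (a * q ^+ n).
Proof.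
elim: n => [|n ->]; first by rewrite /qprod big_ord0 mul1r expr0 mulr1.
by rewrite qprodS -mulrA; congr (_ * _); rewrite qpochS exprS mulrCA.
Qed.

Lemma qpoch_eq0 a : qpoch q a = 0 -> exists n, a * q ^+ n = 1.
Proof.
move=> Ea; apply: contrapT => H.
have n01 : 0 < normc (qpoch q 0) by rewrite qpoch0 normc1.
have /cont_normcP/(_ _ n01)[d d0 dP] := @ccont_qpoch 0.
have [n nP] := @expr_eventually_small _ q a d q1 d0.
have := dP (a * q ^+ n); rewrite subr0 => /(_ nP).
have /eqP : qprod a n * qpoch q (a * q ^+ n) = 0 by rewrite -qpoch_split.
rewrite mulf_eq0 => /orP[|/eqP ->]; last by rewrite sub0r normcN ltxx.
rewrite /qprod prodf_seq_eq0 => /hasP[j _ /andP[_]].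
by rewrite subr_eq0 eq_sym => /eqP aj; case: H; exists j.
Qed.

(** Iterating the functional equation expresses both functions through their
    values near 0. *)
Lemma qpoch_unique (f : R[i] -> R[i]) : ccont f 0 -> f 0 = 1 ->
  (forall a, f a = (1 - a) * f (q * a)) -> forall a, f a = qpoch q a.
Proof.
move=> cf f0 fS a.
have fsplit n : f a = qprod a n * f (a * q ^+ n).
  elim: n => [|n ->]; first by rewrite /qprod big_ord0 mul1r expr0 mulr1.
  by rewrite qprodS -mulrA; congr (_ * _); rewrite fS exprS mulrCA.
pose h w := f w - qpoch q w.
have hsplit n : h a = qprod a n * h (a * q ^+ n).
  by rewrite /h {1}(fsplit n) {1}(qpoch_split a n) mulrBr.
have ch : ccont h 0.
  by apply: ccontD; [exact: cf|apply: ccontN; apply: ccont_qpoch].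
have h0 : h 0 = 0 by rewrite /h f0 qpoch0 subrr.
have [B B0 HB] := qprod_bound (normc_ge0 a).
apply/eqP; rewrite -subr_eq0 -/(h a) -normc_eq0; apply: contraT => ha.
have ha0 : 0 < normc (h a) by rewrite lt_neqAle normc_ge0 eq_sym ha.
have e0 : 0 < normc (h a) / (B + 1) by rewrite divr_gt0 // ltr_wpDl.
have /cont_normcP/(_ _ e0)[d d0 dP] := ch.
have [n nP] := @expr_eventually_small _ q a d q1 d0.
have := dP (a * q ^+ n); rewrite subr0 h0 subr0 => /(_ nP) hs.
have : normc (h a) <= B * (normc (h a) / (B + 1)).
  rewrite {1}(hsplit n) normcM ler_pM ?normc_ge0 //; [exact: HB|exact: ltW].
rewrite mulrA ler_pdivlMr ?ltr_wpDl // mulrC ler_pM2r // => H.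
by move: H; rewrite gerDl ler10.
Qed.

End QPochhammer.

(** * The theta function *)

Lemma theta_p_alg (F : fieldType) (x u v : F) : x != 0 ->
  u * ((1 - x^-1) * v) = - ((1 - x) * u * v / x).
Proof. by move=> x0; field. Qed.

Lemma sqr_factor_alg (F : fieldType) (c t : F) :
  1 - c ^+ 2 * t ^+ 2 = (1 - c * t) * (1 - - c * t).
Proof. by ring. Qed.

Lemma sqr_quotient_alg (F : fieldType) (q c : F) : q != 0 -> c != 0 ->
  q / c ^+ 2 = q ^+ 2 / (q * c ^+ 2).
Proof. by move=> q0 c0; field; apply/andP. Qed.

Section ThetaFunction.
Context {R : realType} (p : R[i]) (p0 : p != 0) (p1 : normc p < 1).
Implicit Types (x y z w : R[i]).
Local Notation E := (qpoch p).
Local Notation th := (theta p).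

Lemma theta_pE x : x != 0 -> th (p * x) = - (th x / x).
Proof.
move=> x0; have -> : th (p * x) = E (p * x) * E (x^-1).
  by rewrite /theta invfM mulVKf.
rewrite /theta (qpochS p1 x) (qpochS p1 x^-1).
move: (E (p * x)) (E (p / x)) => u v.
exact: theta_p_alg.
Qed.

Lemma theta_inv x : x != 0 -> th x^-1 = - (th x / x).
Proof.
move=> x0; rewrite -theta_pE // /theta invrK mulrC; congr (_ * _).
by rewrite invfM mulVKf.
Qed.

Lemma theta1 : th 1 = 0.
Proof. by rewrite /theta (qpochS p1 1) subrr !mul0r. Qed.

Lemma theta_p_eq0 x : x != 0 -> (th (p * x) == 0) = (th x == 0).
Proof.
move=> x0; rewrite theta_pE // oppr_eq0 mulf_eq0 invr_eq0 (negPf x0) orbF //.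
Qed.

Lemma theta_pX (n : nat) x : x != 0 -> (th (p ^+ n * x) == 0) = (th x == 0).
Proof.
move=> x0; elim: n => [|n IH]; first by rewrite expr0 mul1r.
by rewrite exprS -mulrA theta_p_eq0 // mulf_neq0 // expf_neq0.
Qed.

Lemma theta_pZ (k : int) x : x != 0 -> (th (p ^ k * x) == 0) = (th x == 0).
Proof.
move=> x0; case: k => n; first exact: theta_pX.
rewrite NegzE -exprnN -(@theta_pX n.+1 (p ^- n.+1 * x)); last first.
  by rewrite mulf_neq0 // invr_eq0 expf_neq0.
by rewrite mulrA divff ?mul1r // expf_neq0.
Qed.

Lemma theta_eq0P x : x != 0 -> th x = 0 <-> exists k : int, x = p ^ k.
Proof.
move=> x0; split=> [/eqP|[k ->]]; last first.
  by apply/eqP; rewrite -[p ^ k]mulr1 theta_pZ ?oner_neq0 // theta1.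
rewrite /theta mulf_eq0 => /orP[] /eqP/(qpoch_eq0 p1)[n nE].
  exists (- n%:Z); rewrite -exprnN; apply: (mulIf (expf_neq0 n p0)).
  by rewrite nE mulVf // expf_neq0.
exists n.+1%:Z; apply: (mulIf (invr_neq0 x0)).
by rewrite divff // -exprnP exprS -nE mulrAC.
Qed.

Lemma cderiv_theta x : x != 0 -> exists d, cderiv th x d.
Proof.
move=> x0; have [d1 D1] := cderiv_qpoch p1 x.
have [d2 D2] := cderiv_qpoch p1 (p / x).
have DV := cderivZ p (cderivV x0).
exact: ex_intro _ _ (cderivM D1 (cderiv_comp DV D2)).
Qed.

(** At 1 the zero comes from the factor [1 - w] of the product, and the
    quasi-periodicity carries it to the other powers of [p]. *)
Lemma theta_simple_zero x : x != 0 ->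
  exists2 d, cderiv th x d & th x = 0 -> d != 0.
Proof.
move=> x0; have [tx|tx] := eqVneq (th x) 0; last first.
  by have [d D] := cderiv_theta x0; exists d => // /eqP; rewrite (negPf tx).
suff : exists2 d, cderiv th x d & d != 0 by case=> d D d0; exists d.
have [k ->] := (theta_eq0P x0).1 tx => {x x0 tx}.
pose simple x := exists2 d, cderiv th x d & d != 0.
have s1 : simple 1.
  have [d1 D1] := cderiv_qpoch p1 (p * 1).
  have [d2 D2] := cderiv_qpoch p1 (p * 1^-1).
  have Dp := cderivZ p (cderiv_id (1 : R[i])).
  have DV := cderivZ p (cderivV (oner_neq0 R[i])).
  have DM := cderivM (cderiv_comp Dp D1) (cderiv_comp DV D2).
  have D0 := cderivD (cderiv_cst 1 1) (cderivZ (-1) (cderiv_id (1 : R[i]))).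
  have D := cderivM D0 DM.
  have Ep : E p != 0.
    apply/eqP => /(qpoch_eq0 p1)[n]; rewrite -exprS => /(congr1 (@normc R)) /eqP.
    by rewrite normcX normc1 lt_eqF // exprn_ilt1 ?normc_ge0.
  have thE : th = fun w => (1 + -1 * w) * (E (p * w) * E (p / w)).
    by apply/funext => w; rewrite /theta mulN1r (qpochS p1 w) mulrA.
  rewrite /simple thE; eexists; first exact: D.
  have -> : 1 + -1 * 1 = 0 :> R[i] by rewrite mulr1 subrr.
  by rewrite mul0r !add0r mulr1 mulN1r oppr_eq0 invr1 !mulr1 mulf_neq0.
have zero (j : int) : p ^ j != 0 /\ th (p ^ j) = 0.
  have pj : p ^ j != 0 by rewrite expfz_neq0.
  by split=> //; apply: (theta_eq0P pj).2; exists j.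
have near0 (x y : R[i]) : x != 0 -> normc (y - x) < normc x -> y != 0.
  by move=> x0; apply: contraTneq => ->; rewrite sub0r normcN ltxx.
have up x : x != 0 -> th x = 0 -> simple x -> simple (p * x).
  move=> x0 tx [d D d0]; have px : p * x != 0 by rewrite mulf_neq0.
  have E1 : p^-1 * (p * x) = x by rewrite mulKf.
  have Dp := cderivZ p^-1 (cderiv_id (p * x)); rewrite mulr1 in Dp.
  have D' : cderiv th (p^-1 * (p * x)) d by rewrite E1.
  have x0' : p^-1 * (p * x) != 0 by rewrite E1.
  have DV := cderivV x0'.
  have DM := cderivZ (-1) (cderivM (cderiv_comp Dp D') (cderiv_comp Dp DV)).
  have nx : 0 < normc (p * x) by rewrite normc_gt0.
  eexists.
    apply: (cderiv_local nx _ DM) => y /(near0 _ _ px) y0.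
    by rewrite mulN1r -theta_pE ?mulf_neq0 ?invr_eq0 // mulVKf.
  rewrite /= E1 tx mul0r add0r mulN1r oppr_eq0 !mulf_neq0 ?invr_eq0 //.
have down x : x != 0 -> th (p * x) = 0 -> simple (p * x) -> simple x.
  move=> x0 tx [d D d0]; have px : p * x != 0 by rewrite mulf_neq0.
  have Dp := cderivZ p (cderiv_id x); rewrite mulr1 in Dp.
  have DM := cderivZ (-1) (cderivM (cderiv_id x) (cderiv_comp Dp D)).
  have nx : 0 < normc x by rewrite normc_gt0.
  eexists.
    apply: (cderiv_local nx _ DM) => y /(near0 _ _ x0) y0.
    by rewrite theta_pE // mulrN mulN1r opprK mulrC divfK.
  by rewrite /= tx mulr0 addr0 mulN1r oppr_eq0 !mulf_neq0.
case: k => n.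
  elim: n => [|n IH]; first by rewrite expr0z.
  by have [H1 H2] := zero n; rewrite -exprnP exprS; apply: up.
rewrite NegzE -exprnN; elim: n.+1 => [|m IH]; first by rewrite expr0 invr1.
have [H1 H2] := zero (- m.+1%:Z); have [H3 H4] := zero (- m%:Z).
have E1 : p * p ^- m.+1 = p ^- m by rewrite exprS invfM mulVKf.
by apply: down; [rewrite exprnN|rewrite E1 exprnN|rewrite E1].
Qed.

Lemma ccont_theta x : x != 0 -> ccont th x.
Proof. by move=> /cderiv_theta[d /cderiv_cont]. Qed.

Lemma p2_lt1 : normc (p ^+ 2) < 1.
Proof. by rewrite normcX exprn_ilt1 ?normc_ge0. Qed.

(** The two factors on the right collect the even and the odd powers of [p]. *)
Lemma qpoch_even_odd a : E a = qpoch (p ^+ 2) a * qpoch (p ^+ 2) (p * a).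
Proof.
apply: esym; apply: (qpoch_unique p1 (f := fun a => qpoch (p ^+ 2) a * qpoch (p ^+ 2) (p * a))).
- apply: ccontM; first by apply: ccont_qpoch; exact: p2_lt1.
  apply: (@ccont_comp _ (qpoch (p ^+ 2)) (fun w => p * w)).
    by apply: ccontM; [exact: ccont_cst|exact: ccont_id].
  by apply: ccont_qpoch; exact: p2_lt1.
- by rewrite mulr0 !qpoch0 ?p2_lt1 // mulr1.
move=> b; rewrite (qpochS p2_lt1 b) -mulrA; congr (_ * _).
by rewrite mulrC mulrA.
Qed.

Lemma qpoch_sqr c : qpoch (p ^+ 2) (c ^+ 2) = E c * E (- c).
Proof.
apply: (qprod_lim (q := p ^+ 2)).
have -> : qprod (p ^+ 2) (c ^+ 2) = (fun n => qprod p c n * qprod p (- c) n).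
  apply/funext => n; rewrite /qprod -big_split /=; apply: eq_bigr => j _.
  by rewrite exprAC; exact: sqr_factor_alg.
by apply: (@cvgM R[i]); exact: qprod_cvg.
Qed.

Lemma theta_sqr c : c != 0 ->
  th (c ^+ 2) = th c * th (- c) * theta (p ^+ 2) (p * c ^+ 2).
Proof.
move=> c0; rewrite {1}/theta (qpoch_even_odd (c ^+ 2)) (qpoch_even_odd (p / c ^+ 2)).
have -> : p * (p / c ^+ 2) = (p / c) ^+ 2 by rewrite expr_div_n expr2 mulrA.
have -> : p / c ^+ 2 = p ^+ 2 / (p * c ^+ 2).
  exact: sqr_quotient_alg.
rewrite !qpoch_sqr /theta invrN mulrN.
move: (E c) (E (- c)) (E (p / c)) (E (- (p / c))) => u v w z.
move: (qpoch _ _) (qpoch _ _) => s t.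
by ring.
Qed.

Lemma theta_N1_neq0 : th (-1) != 0.
Proof.
have N1 : -1 != 0 :> R[i] by rewrite oppr_eq0 oner_neq0.
apply/eqP => /(theta_eq0P N1)[k kE].
have nk : normc p ^ k = 1.
  case: k kE => n kE; have := congr1 (@normc R) kE; rewrite normcN normc1.
    by rewrite -exprnP normcX.
  by rewrite NegzE -!exprnN normcV normcX.
have : k = 0.
  apply/eqP; apply: contraT => k0; move/eqP: nk.
  rewrite pexprz_eq1 ?normc_ge0 // (negPf k0) /= => /eqP pE.
  by move: p1; rewrite pE ltxx.
move=> k0; move: kE; rewrite k0 expr0z => /eqP.
by rewrite eq_sym -subr_eq0 opprK -(natrD _ 1 1) pnatr_eq0.
Qed.

End ThetaFunction.

(** * Spaces of theta functions and their zeros *)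

Section ThetaSpace.
Context {R : realType} (p : R[i]) (p0 : p != 0) (p1 : normc p < 1).
Implicit Types (x y z w s b : R[i]) (f g : R[i] -> R[i]).
Local Notation th := (theta p).

(** [A_theta] in Caratheodory's form and with degree 0 allowed, so that monomials
    and empty products are covered. *)
Definition theta_space (m : nat) (s : R[i]) (f : R[i] -> R[i]) :=
  [/\ s != 0, forall x, x != 0 -> exists d, cderiv f x d &
      forall x, x != 0 -> f (p * x) = (-1) ^+ m / (s * x ^+ m) * f x].

Lemma A_theta_space m s f : A_theta p m s f -> theta_space m s f.
Proof. by case=> _ s0 hf fp; split=> // x x0; apply/derivable_cderiv/hf. Qed.

Lemma theta_space_theta b : b != 0 -> theta_space 1 b (fun x => th (b * x)).
Proof.
move=> b0; split=> // x x0.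
  have [d D] := cderiv_theta p1 (mulf_neq0 b0 x0).
  exact: ex_intro _ _ (cderiv_comp (cderivZ b (cderiv_id x)) D).
rewrite mulrCA theta_pE ?mulf_neq0 // !expr1.
by rewrite mulN1r mulNr mulrC.
Qed.

Lemma quasi_period_mul_alg (F : fieldType) (e1 e2 s1 s2 u v a b : F) :
  e1 / (s1 * u) * a * (e2 / (s2 * v) * b) = e1 * e2 / (s1 * s2 * (u * v)) * (a * b).
Proof. by rewrite !invfM; ring. Qed.

Lemma theta_spaceM m1 m2 s1 s2 f g : theta_space m1 s1 f -> theta_space m2 s2 g ->
  theta_space (m1 + m2) (s1 * s2) (fun x => f x * g x).
Proof.
move=> [s10 df fp] [s20 dg gp]; split; first by rewrite mulf_neq0.
  move=> x x0; have [a A] := df x x0; have [b B] := dg x x0.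
  exact: ex_intro _ _ (cderivM A B).
by move=> x x0; rewrite fp // gp // quasi_period_mul_alg -!exprD.
Qed.

Lemma theta_spaceZ m s f b : theta_space m s f -> theta_space m s (fun x => b * f x).
Proof.
move=> [s0 df fp]; split=> //.
  by move=> x x0; have [a A] := df x x0; exists (b * a); exact: cderivZ.
by move=> x x0; rewrite fp // mulrCA.
Qed.

Lemma theta_spaceD m s f g : theta_space m s f -> theta_space m s g ->
  theta_space m s (fun x => f x + g x).
Proof.
move=> [s0 df fp] [_ dg gp]; split=> //.
  move=> x x0; have [a A] := df x x0; have [b B] := dg x x0.
  exact: ex_intro _ _ (cderivD A B).
by move=> x x0; rewrite fp // gp // mulrDr.
Qed.

Lemma theta_spaceB m s f g : theta_space m s f -> theta_space m s g ->
  theta_space m s (fun x => f x - g x).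
Proof.
move=> hf /(theta_spaceZ (-1)) hg; have := theta_spaceD hf hg.
by under eq_fun do rewrite mulN1r.
Qed.

Lemma theta_space_sum m s (I : Type) (r : seq I) (F : I -> R[i] -> R[i]) : s != 0 ->
  (forall i, theta_space m s (F i)) ->
  theta_space m s (fun x => \sum_(i <- r) F i x).
Proof.
move=> s0 HF; elim: r => [|i r IH].
  under eq_fun do rewrite big_nil; split=> // x x0; last by rewrite mulr0.
  by exists 0; exact: cderiv_cst.
by under eq_fun do rewrite big_cons; exact: theta_spaceD.
Qed.

Lemma theta_space1 : theta_space 0 1 (fun=> 1).
Proof.
split=> [|x x0|x x0]; rewrite ?oner_neq0 //; first by exists 0; exact: cderiv_cst.
by rewrite !expr0 !mulr1 invr1 mulr1.
Qed.

Lemma theta_space_prod (I : Type) (r : seq I) (P : pred I) (m : I -> nat)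
    (s : I -> R[i]) (F : I -> R[i] -> R[i]) :
  (forall i, P i -> theta_space (m i) (s i) (F i)) ->
  theta_space (\sum_(i <- r | P i) m i) (\prod_(i <- r | P i) s i)
    (fun x => \prod_(i <- r | P i) F i x).
Proof.
move=> HF; elim: r => [|i r IH].
  rewrite !big_nil.
  have -> : (fun x => \prod_(i <- [::] | P i) F i x) = fun=> 1.
    by apply/funext => x; rewrite big_nil.
  exact: theta_space1.
rewrite !big_cons.
have -> : (fun x => \prod_(j <- i :: r | P j) F j x) = fun x =>
    if P i then F i x * \prod_(j <- r | P j) F j x else \prod_(j <- r | P j) F j x.
  by apply/funext => x; rewrite big_cons.
by case: ifP => // Pi; apply: theta_spaceM => //; exact: HF.
Qed.

Lemma theta_space_zeros m s f y (k : int) : y != 0 -> theta_space m s f ->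
  f y = 0 -> f (y * p ^ k) = 0.
Proof.
move=> y0 [s0 _ fp].
have fp0 x : x != 0 -> (f (p * x) == 0) = (f x == 0).
  move=> x0; rewrite fp // mulf_eq0 mulf_eq0 invr_eq0 signr_eq0 mulf_eq0.
  by rewrite (negPf s0) expf_eq0 (negPf x0) andbF.
have up (n : nat) x : x != 0 -> (f (x * p ^+ n) == 0) = (f x == 0).
  move=> x0; elim: n => [|n IH]; first by rewrite expr0 mulr1.
  by rewrite exprS mulrCA fp0 // mulf_neq0 // expf_neq0.
move=> /eqP fy; apply/eqP; case: k => n; first by rewrite -exprnP up.
have y'0 : y * p ^- n.+1 != 0 by rewrite mulf_neq0 // invr_eq0 expf_neq0.
rewrite NegzE -exprnN -(up n.+1 _ y'0) -mulrA mulVf ?expf_neq0 // mulr1.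
exact: fy.
Qed.

Lemma cexpMz w (k : int) : cexp (w *~ k) = cexp w ^ k.
Proof.
case: k => n; first by rewrite -pmulrn cexpMn.
by rewrite NegzE mulrNz -pmulrn cexpN cexpMn -exprnN.
Qed.

(** Subtracting the integer part of [al] leaves [0 <= d < 1], and
    [cos (2 pi d) = 1] forces [sin (pi d) = 0]. *)
Lemma cexp_eq1_imaginary (al : R) :
  cexp (al%:C * (0 +i* (pi *+ 2))) = 1 -> exists k : int, al = k%:~R.
Proof.
move=> e1; exists (Num.floor al); set k := Num.floor al.
pose d := al - k%:~R.
have d0 : 0 <= d by rewrite subr_ge0 floor_le.
have d1 : d < 1.
  by rewrite ltrBlDl; have := lt_succ_floor al; rewrite intrD.
apply/eqP; rewrite -subr_eq0 -/d; apply: contraT => dn0.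
have dgt : 0 < d by rewrite lt_neqAle eq_sym dn0.
have e2 : cexp (0 +i* (d * (pi *+ 2))) = 1.
  have -> : 0 +i* (d * (pi *+ 2)) = al%:C * (0 +i* (pi *+ 2))
      + (0 +i* (pi *+ 2)) *~ (- k) :> R[i].
    have -> : (0 +i* (pi *+ 2)) *~ (- k) = 0 +i* ((pi *+ 2) *~ (- k)) :> R[i].
      apply/eqP; rewrite eq_complex; apply/andP; split; apply/eqP.
        rewrite (raddfMz (@complex.Re R : Rcomplex R -> R)).
        by rewrite /= mul0rz.
      exact: (raddfMz (@complex.Im R : Rcomplex R -> R)).
    apply/eqP; rewrite eq_complex /= !mul0r !mulr0 subr0 addr0 addr0 eqxx /=.
    by rewrite mulrNz -mulrzr /d; apply/eqP; ring.
  by rewrite cexpD e1 mul1r cexpMz cexp_2pi exp1rz.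
have := congr1 (@complex.Re R) e2; rewrite /cexp /= expR0 mul1r => c1.
have s0 : sin (d * pi) = 0.
  apply/eqP; rewrite -sqrf_eq0; apply/eqP.
  have : cos (d * pi *+ 2) = 1 by rewrite -mulrnAr; exact: c1.
  rewrite mulr2n cosD -!expr2; have := cos2Dsin2 (d * pi); lra.
have : 0 < sin (d * pi).
  by rewrite sin_gt0_pi // mulr_gt0 ?pi_gt0 //= gtr_pMl ?pi_gt0.
by rewrite s0 ltxx.
Qed.

End ThetaSpace.

Section Interpolation.
Context {R : realType} (p : R[i]) (p0 : p != 0) (p1 : normc p < 1).
Implicit Types (x y z w s b : R[i]) (f g : R[i] -> R[i]).
Local Notation th := (theta p).

Lemma div_period_alg (F : fieldType) (e s Y v : F) : s != 0 ->
  e * Y / v = s * Y * (e / (s * v)).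
Proof.
move=> s0; rewrite invfM; have [->|v0] := eqVneq v 0; first by rewrite invr0 !mulr0.
by field; exact/andP.
Qed.

Lemma twist_alg (F : fieldType) (a b c n u : F) : n != 0 ->
  a * u = c * n^-1 -> a * (n * u * b) = c * b.
Proof.
by move=> n0 H; rewrite mulrA mulrCA H mulrCA divff // mulr1.
Qed.

(** A quotient of a theta function by a product of thetas with the same zeros is
    multiplied by a constant under [x -> p x]; in a logarithmic coordinate it
    can be twisted by an exponential into a function with doubly periodic
    modulus, hence it is constant. The condition on the norm excludes that
    this exponential is an integral power of [x]. *)
Theorem theta_space_vanish (I : finType) s f (y : I -> R[i]) :
  theta_space p #|I| s f -> (forall i, y i != 0) ->
  (forall i j, i != j -> th (y i / y j) != 0) ->
  th (s * \prod_i y i) != 0 -> (forall i, f (y i) = 0) ->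
  forall x, x != 0 -> f x = 0.
Proof.
move=> hf y0 yij sY fy; have [s0 df fp] := hf.
set Y := \prod_i y i in sY.
have Y0 : Y != 0 by apply/prodf_neq0 => i _.
pose T x := \prod_i th ((y i)^-1 * x).
have hT : theta_space p #|I| Y^-1 T.
  have := @theta_space_prod R p I (index_enum I) xpredT (fun=> 1%N) (fun i => (y i)^-1)
    (fun i x => th ((y i)^-1 * x)) (fun i _ => theta_space_theta p0 p1 (invr_neq0 (y0 i))).
  by rewrite sum1_card prodfV.
have Tp := let: And3 _ _ h := hT in h.
have [l lE _] := cexp_surj (invr_neq0 p0).
have l0 : 0 < Re l.
  by rewrite -(ltr_expR 0) expR0 -normc_cexp lE normcV invf_gt1 // normc_gt0.
(* the twist by [exp (al w)] that makes the modulus of the quotient invariant *)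
pose al := - (ln (normc (s * Y)) / Re l).
have sY0 : s * Y != 0 by rewrite mulf_neq0.
have alP : normc (cexp (al%:C * l)) = (normc (s * Y))^-1.
  rewrite normc_cexp; have -> : Re (al%:C * l) = al * Re l.
    by case: (l) => ? ? /=; rewrite mul0r subr0.
  by rewrite /al mulNr divfK ?gt_eqF // expRN lnK // posrE normc_gt0.
pose F w := f (cexp w) * cexp (al%:C * w).
pose G w := T (cexp w).
have dE w : cderiv (fun w => cexp (al%:C * w)) w (cexp (al%:C * w) * al%:C).
  have := cderiv_comp (cderivZ al%:C (cderiv_id w)) (cderiv_cexp _).
  by rewrite mulr1.
have dF w : exists d, cderiv F w d.
  have [d D] := df (cexp w) (cexp_neq0 w).
  exact: ex_intro _ _ (cderivM (cderiv_comp (cderiv_cexp w) D) (dE w)).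
have dT x : x != 0 -> exists2 d, cderiv T x d & T x = 0 -> d != 0 /\ f x = 0.
  move=> x0; have [/eqP Tx|Tx] := eqVneq (T x) 0; last first.
    have [_ /(_ x x0)[d D] _] := hT; exists d => // /eqP; by rewrite (negPf Tx).
  move: (Tx); rewrite prodf_seq_eq0 => /hasP[i _ /andP[_ /eqP ti]].
  have yx0 j : (y j)^-1 * x != 0 by rewrite mulf_neq0 ?invr_eq0.
  have [d D d0] := theta_simple_zero p0 p1 (yx0 i).
  have D1 := cderiv_comp (cderivZ (y i)^-1 (cderiv_id x)) D.
  have hTi := @theta_space_prod R p I (index_enum I) (fun j => j != i) (fun=> 1%N)
    (fun i => (y i)^-1) (fun i x => th ((y i)^-1 * x))
    (fun i _ => theta_space_theta p0 p1 (invr_neq0 (y0 i))).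
  have [d2 D2] := let: And3 _ h _ := hTi in h x x0.
  have D3 := cderivM D1 D2.
  have TE : T = fun x => th ((y i)^-1 * x) * \prod_(j | j != i) th ((y j)^-1 * x).
    by apply/funext => u; rewrite /T (bigD1 i).
  rewrite TE; eexists; first exact: D3.
  move=> _; have [k kE] := (theta_eq0P p0 p1 (yx0 i)).1 ti.
  have xE : x = y i * p ^ k by rewrite -kE mulVKf.
  split; last by rewrite xE; exact: theta_space_zeros hf (fy i).
  rewrite ti mul0r add0r mulr1 !mulf_neq0 ?invr_eq0 ?d0 //.
  apply/prodf_neq0 => j ji; rewrite xE mulrA mulrC theta_pZ //; last first.
    by rewrite mulf_neq0 ?invr_eq0.
  by rewrite mulrC yij // eq_sym.
have dG w : exists2 d, cderiv G w d & G w = 0 -> d != 0 /\ F w = 0.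
  have [d D dP] := dT (cexp w) (cexp_neq0 w).
  eexists; first exact: cderiv_comp (cderiv_cexp w) D.
  move=> /dP[d0 fw]; split; first by rewrite mulf_neq0 // cexp_neq0.
  by rewrite /F fw mul0r.
have cexpl w : cexp w = p * cexp (w + l) by rewrite cexpD lE mulrCA divff // mulr1.
have perl w : F (w + l) * ((-1) ^+ #|I| / (s * cexp (w + l) ^+ #|I|))
    = F w * cexp (al%:C * l).
  rewrite /F (cexpl w) fp ?cexp_neq0 // mulrDr (cexpD (al%:C * w)).
  by move: (f _) (cexp (_ * w)) (cexp (_ * l)) (_ / _) => a b c d; ring.
have Gl w : G w = s * Y * ((-1) ^+ #|I| / (s * cexp (w + l) ^+ #|I|)) * G (w + l).
  rewrite /G {1}(cexpl w) Tp ?cexp_neq0 // -div_period_alg //.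
  by rewrite invfM invrK mulrA.
have mu0 w : (-1) ^+ #|I| / (s * cexp (w + l) ^+ #|I|) != 0.
  by rewrite mulf_neq0 ?signr_eq0 // invr_eq0 mulf_neq0 // expf_neq0 // cexp_neq0.
pose P := 0 +i* (pi *+ 2) : R[i].
have cexpP w : cexp (w + P) = cexp w by rewrite cexpD cexp_2pi mulr1.
have GP w : G (w + P) = G w by rewrite /G cexpP.
have FP w : F (w + P) = F w * cexp (al%:C * P).
  by rewrite /F cexpP mulrDr cexpD mulrA.
have [|k kP] := @quotient_liouville R F G l l0 dF dG.
  move=> v [] -> w; last first.
    rewrite GP FP normcM normc_cexp.
    have -> : Re (al%:C * P) = 0 by rewrite /= mulr0 mul0r subrr.
    by rewrite expR0 mulr1.
  rewrite (Gl w); move: (perl w); set mu := _ / (_ * _) => /(congr1 (@normc R)).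
  rewrite (normcM _ mu) (normcM (F w) (cexp (al%:C * l))) alP.
  rewrite (normcM _ (G (w + l))) (normcM (s * Y)).
  move=> H; apply: twist_alg H; rewrite gt_eqF // normc_gt0 //.
have [k0|k0] := eqVneq k 0.
  move=> x x0; have [w <- _] := cexp_surj x0.
  have /eqP := kP w; rewrite k0 mul0r mulf_eq0 (negPf (cexp_neq0 _)) orbF.
  by move=> /eqP.
exfalso.
have [w Gw] : exists w, G w != 0.
  have [d D dP] := dG 0.
  have [|e e0 H] := cderiv_neq0_near D.
    by case: eqVneq => [/dP[]|]; [right|left].
  exists (e / 2)%:C; apply: H.
    by rewrite subr0 normc_real gtr0_norm ?divr_gt0 //; lra.
  by rewrite -normc_gt0 normc_real gtr0_norm ?divr_gt0.
have Fw : F w != 0 by rewrite kP mulf_neq0.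
have e1 : cexp (al%:C * P) = 1.
  by apply: (mulfI Fw); rewrite -FP kP GP -kP mulr1.
(* so the twist is the power [x^n], and [s * Y] would have to be a power of [p] *)
have [n nE] := cexp_eq1_imaginary e1.
have e2 : cexp (al%:C * l) = p ^ (- n).
  rewrite nE; have -> : (n%:~R : R)%:C * l = l *~ n.
    by rewrite rmorph_int mulrzl.
  by rewrite cexpMz lE exprz_inv.
have Gwl : G (w + l) != 0 by move: Gw; rewrite Gl mulf_eq0 negb_or => /andP[].
have := perl w; rewrite !kP (Gl w) e2.
set mu := _ / _; move=> H.
have H2 : s * Y * p ^ (- n) = 1.
  have z0 : k * G (w + l) * mu != 0 by apply: mulf_neq0; [apply: mulf_neq0|exact: mu0].
  apply: (mulfI z0); rewrite mulr1 [RHS]H.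
  by move: (G _) => g; ring.
move/eqP: sY; apply.
have -> : s * Y = p ^ n.
  by apply: (mulIf (expfz_neq0 (- n) p0)); rewrite H2 -expfzDr // subrr expr0z.
apply: (theta_eq0P p0 p1 (expfz_neq0 n p0)).2; by exists n.
Qed.

End Interpolation.

(** * Points in general position *)

Section Paths.
Context {R : realType}.
Implicit Types (x y z w s b t : R[i]) (f g : R[i] -> R[i]).

Definition near0 (Q : R[i] -> Prop) :=
  exists2 d : R, 0 < d & forall t, normc t < d -> t != 0 -> Q t.

Lemma near0_and (Q1 Q2 : R[i] -> Prop) : near0 Q1 -> near0 Q2 ->
  near0 (fun t => Q1 t /\ Q2 t).
Proof.
move=> [d1 d10 H1] [d2 d20 H2]; exists (Num.min d1 d2); first by rewrite lt_min d10.
by move=> t; rewrite lt_min => /andP[t1 t2] t0; split; [exact: H1|exact: H2].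
Qed.

Lemma near0_forall (I : finType) (Q : I -> R[i] -> Prop) :
  (forall i, near0 (Q i)) -> near0 (fun t => forall i, Q i t).
Proof.
move=> H; suff : forall r : seq I, near0 (fun t => forall i, i \in r -> Q i t).
  move=> /(_ (enum I))[d d0 dP]; exists d => // t td t0 i.
  by apply: dP => //; rewrite mem_enum.
elim=> [|i r IH]; first by exists 1; rewrite ?ltr01.
have [d d0 dP] := near0_and (H i) IH; exists d => // t td t0 j.
have [Qi Qr] := dP t td t0.
by rewrite inE => /orP[/eqP ->//|]; exact: Qr.
Qed.

Lemma near0_ex (Q : R[i] -> Prop) : near0 Q -> exists t, Q t.
Proof.
move=> [d d0 dP]; have d20 : 0 < d / 2 by rewrite divr_gt0.
have nt : normc (d / 2)%:C = d / 2 by rewrite normc_real gtr0_norm.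
exists (d / 2)%:C; apply: dP; first by rewrite nt; lra.
by rewrite -normc_gt0 nt.
Qed.

Lemma near0_eq f g : ccont f 0 -> ccont g 0 -> near0 (fun t => f t = g t) ->
  f 0 = g 0.
Proof.
move=> cf cg [d d0 dP]; apply/eqP; rewrite -subr_eq0; apply: contraT => fg.
have ch : ccont (fun t => f t - g t) 0 by apply: ccontD; [exact: cf|exact: ccontN].
have n0 : 0 < normc (f 0 - g 0) by rewrite normc_gt0.
have /cont_normcP/(_ _ n0)[e e0 H] := ch.
have [|t [H1 H2]] := @near0_ex (fun t => f t = g t /\ normc (t - 0) < e).
  apply: near0_and; first by exists d.
  by exists e => // t; rewrite subr0.
by have := H t H2; rewrite H1 subrr sub0r normcN ltxx.
Qed.

Lemma ccont_sum (I : Type) (r : seq I) (Q : pred I) (F : I -> R[i] -> R[i]) z :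
  (forall i, Q i -> ccont (F i) z) -> ccont (fun w => \sum_(i <- r | Q i) F i w) z.
Proof.
move=> H; elim: r => [|i r IH].
  by under eq_fun do rewrite big_nil; exact: ccont_cst.
under eq_fun do rewrite big_cons.
by case: ifP => [Qi|_]; [apply: ccontD; [exact: H|exact: IH]|exact: IH].
Qed.

Lemma ccont_det n (A : R[i] -> 'M[R[i]]_n) z :
  (forall i j, ccont (fun w => A w i j) z) -> ccont (fun w => \det (A w)) z.
Proof.
move=> H; rewrite /determinant; apply: ccont_sum => s _.
apply: ccontM; first exact: ccont_cst.
by apply: ccont_prod => i _; exact: H.
Qed.

Lemma ccontX f n z : ccont f z -> ccont (fun w => f w ^+ n) z.
Proof.
move=> cf; elim: n => [|n IH]; first exact: ccont_cst.
have -> : (fun w => f w ^+ n.+1) = fun w => f w * f w ^+ n.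
  by apply/funext => w; rewrite exprS.
by apply: ccontM; [exact: cf|exact: IH].
Qed.

Lemma cexp_sum (I : Type) (r : seq I) (Q : pred I) (F : I -> R[i]) :
  cexp (\sum_(i <- r | Q i) F i) = \prod_(i <- r | Q i) cexp (F i).
Proof. by rewrite (big_morph _ (@cexpD R) (@cexp0 R)). Qed.

(** A point moving along a one-parameter group with speed [n]; products and
    inverses of such points move in the same way. *)
Definition flow b n t : R[i] := b * cexp (n * t).

Lemma flow0 b n : flow b n 0 = b.
Proof. by rewrite /flow mulr0 cexp0 mulr1. Qed.

Lemma flow_neq0 b n t : b != 0 -> flow b n t != 0.
Proof. by move=> b0; rewrite mulf_neq0 // cexp_neq0. Qed.

Lemma flowV b n t : (flow b n t)^-1 = flow b^-1 (- n) t.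
Proof. by rewrite /flow invfM mulNr cexpN. Qed.

Lemma flowM b1 b2 n1 n2 t : flow b1 n1 t * flow b2 n2 t = flow (b1 * b2) (n1 + n2) t.
Proof. by rewrite /flow mulrACA -cexpD -mulrDl. Qed.

Lemma ccont_flow b n z : ccont (flow b n) z.
Proof.
apply: ccontM; first exact: ccont_cst.
apply: (@ccont_comp _ cexp (fun t => n * t)); last exact: ccont_cexp.
by apply: ccontM; [exact: ccont_cst|exact: ccont_id].
Qed.

End Paths.

Section GenericPoints.
Context {R : realType} (p : R[i]) (p0 : p != 0) (p1 : normc p < 1).
Implicit Types (x y z w s b t : R[i]) (f g : R[i] -> R[i]).
Local Notation th := (theta p).

(** The zeros of theta are simple, hence isolated. *)
Lemma near0_theta_neq0 b n : b != 0 -> n != 0 ->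
  near0 (fun t => th (flow b n t) != 0).
Proof.
move=> b0 n0; have b0' : b * cexp (n * 0) != 0 by rewrite mulf_neq0 ?cexp_neq0.
have [d D dP] := theta_simple_zero p0 p1 b0'.
have D1 := cderivZ b (cderiv_comp (cderivZ n (cderiv_id (0 : R[i]))) (cderiv_cexp (n * 0))).
have D2 := cderiv_comp D1 D.
have [|e e0 H] := cderiv_neq0_near D2.
  have [tb|] := eqVneq (th (b * cexp (n * 0))) 0; last by left.
  by right; rewrite mulr1 !mulf_neq0 ?cexp_neq0 //; exact: dP.
by exists e => // t te t0; apply: H; rewrite ?subr0.
Qed.

(** Moving the points with pairwise distinct speeds, and non-zero total speed,
    puts them in the position required for interpolation. *)
Lemma near0_generic_points (I : finType) s (y nu : I -> R[i]) :
  s != 0 -> (forall i, y i != 0) -> injective nu -> \sum_i nu i != 0 ->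
  near0 (fun t => (forall i j, i != j ->
      th (flow (y i) (nu i) t / flow (y j) (nu j) t) != 0) /\
    th (s * \prod_i flow (y i) (nu i) t) != 0).
Proof.
move=> s0 y0 nuI nu0; apply: near0_and.
  apply: near0_forall => i; apply: near0_forall => j.
  have [<-|ij] := eqVneq i j; first by exists 1 => //; rewrite ltr01.
  have [||d d0 H] := @near0_theta_neq0 (y i / y j) (nu i - nu j).
  - by rewrite mulf_neq0 // invr_eq0.
  - by rewrite subr_eq0; apply: contra ij => /eqP/nuI ->.
  by exists d => // t td t0 _; rewrite flowV flowM; exact: H.
have Y0 : s * \prod_i y i != 0 by rewrite mulf_neq0 //; apply/prodf_neq0.
have [d d0 H] := near0_theta_neq0 Y0 nu0; exists d => // t td t0.
have -> : s * \prod_i flow (y i) (nu i) t = flow (s * \prod_i y i) (\sum_i nu i) t.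
  by rewrite /flow big_split /= mulrA -cexp_sum mulr_suml.
exact: H.
Qed.

Lemma ccont_theta_comp g z : g z != 0 -> ccont g z -> ccont (fun w => th (g w)) z.
Proof.
move=> gz cg; apply: (@ccont_comp _ th g); first exact: cg.
by apply: ccont_theta => //; exact: gz.
Qed.

Lemma theta_space_ext m s f g : (forall x, x != 0 -> f x = g x) ->
  theta_space p m s g -> theta_space p m s f.
Proof.
move=> fg [s0 dg gp]; split=> // x x0; last by rewrite !fg ?gp ?mulf_neq0.
have [d D] := dg x x0; exists d; have nx : 0 < normc x by rewrite normc_gt0.
apply: (cderiv_local nx _ D) => w wx; apply: fg.
by apply: contraTneq wx => ->; rewrite sub0r normcN ltxx.
Qed.

Lemma theta_spaceX k : theta_space p 0 (p ^- k) (fun x => x ^+ k).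
Proof.
split=> [|x x0|x x0]; first by rewrite invr_eq0 expf_neq0.
  elim: k => [|k [d D]].
    by exists 0; exact: cderiv_cst.
  have -> : (fun w => w ^+ k.+1) = fun w : R[i] => w * w ^+ k.
    by apply/funext => w; rewrite exprS.
  exact: ex_intro _ _ (cderivM (cderiv_id x) D).
by rewrite !expr0 mulr1 div1r invrK exprMn.
Qed.

Lemma inv_period_alg (F : fieldType) (e s P T h h' : F) : e ^+ 2 = 1 ->
  s != 0 -> P != 0 -> T != 0 -> h' = e / (s * (P * T)^-1) * h ->
  h = e / (P / s * T) * h'.
Proof.
move=> e1 s0 P0 T0 ->; transitivity (e ^+ 2 * h); first by rewrite e1 mul1r.
by field; apply/and3P.
Qed.

(** Substituting [x^-1] inverts the norm, up to a power of [p]. *)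
Lemma theta_space_inv m s f : theta_space p m s f ->
  theta_space p m (p ^+ m / s) (fun x => f x^-1).
Proof.
move=> [s0 df fp]; split; first by rewrite mulf_neq0 ?invr_eq0 ?expf_neq0.
  move=> x x0; have [d D] := df _ (invr_neq0 x0).
  exact: ex_intro _ _ (cderiv_comp (cderivV x0) D).
move=> x x0; have px0 : (p * x)^-1 != 0 by rewrite invr_eq0 mulf_neq0.
apply: inv_period_alg; rewrite ?expf_neq0 ?sqrr_sign //.
have {1}-> : x^-1 = p * (p * x)^-1 by rewrite invfM mulVKf.
by rewrite fp // exprVn exprMn.
Qed.

End GenericPoints.

(** * The determinant of type A *)

Definition upd (T : Type) (x : nat -> T) (n : nat) (t : T) (i : nat) : T :=
  if i == n then t else x i.

Lemma upd_eq (T : Type) (x : nat -> T) n t : upd x n t n = t.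
Proof. by rewrite /upd eqxx. Qed.

Lemma upd_lt (T : Type) (x : nat -> T) n t i : (i < n)%N -> upd x n t i = x i.
Proof. by rewrite /upd => /ltn_eqF ->. Qed.

Lemma upd_id (T : Type) (x : nat -> T) n : upd x n (x n) = x.
Proof. by apply/funext => i; rewrite /upd; case: eqP => [->|]. Qed.

Section LastRow.
Context {K : comNzRingType}.

Lemma det_scale_rows n (u : 'I_n -> K) (A : 'M[K]_n) :
  \det (\matrix_(i, j) (u i * A i j)) = \prod_i u i * \det A.
Proof.
have -> : \matrix_(i, j) (u i * A i j) = diag_mx (\row_i u i) *m A.
  by apply/matrixP => i j; rewrite mul_diag_mx !mxE.
by rewrite det_mulmx det_diag; congr (_ * _); apply: eq_bigr => i _; rewrite mxE.
Qed.

(** Laplace expansion; the cofactors do not see the last point. *)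
Lemma det_last_row n (G : nat -> K -> K) (x : nat -> K) :
  exists cof : 'I_n.+1 -> K, forall t,
    \det (\matrix_(i < n.+1, j < n.+1) G j (upd x n t i)) = \sum_(j < n.+1) G j t * cof j.
Proof.
exists (fun j => cofactor (\matrix_(i < n.+1, j < n.+1) G j (upd x n 0 i)) ord_max j).
move=> t; rewrite (expand_det_row _ ord_max); apply: eq_bigr => j _.
rewrite mxE upd_eq; congr (_ * _); rewrite /cofactor; congr (_ * \det _).
apply/matrixP => i k; rewrite !mxE; congr (G _ _).
by rewrite lift_max !upd_lt.
Qed.

Lemma det_last_row_repeat n (G : nat -> K -> K) (x : nat -> K) k : (k < n)%N ->
  \det (\matrix_(i < n.+1, j < n.+1) G j (upd x n (x k) i)) = 0.
Proof.
move=> kn; have kn1 : (k < n.+1)%N by rewrite ltnS ltnW.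
apply: (@determinant_alternate _ _ _ (Ordinal kn1) ord_max) => [|j].
  by rewrite -val_eqE /= ltn_eqF.
by rewrite !mxE /= upd_eq upd_lt.
Qed.

Lemma det_last_row_corner n (G : nat -> K -> K) (x : nat -> K) t :
  (forall j, (j < n)%N -> G j t = 0) ->
  \det (\matrix_(i < n.+1, j < n.+1) G j (upd x n t i)) =
    G n t * \det (\matrix_(i < n, j < n) G j (x i)).
Proof.
move=> G0; rewrite (expand_det_row _ ord_max) big_ord_recr /= big1 ?add0r => [|j _].
  rewrite mxE /= upd_eq; congr (_ * _); rewrite /cofactor -signr_odd oddD addbb.
  rewrite expr0 mul1r; congr (\det _); apply/matrixP => i j; rewrite !mxE.
  by rewrite !lift_max upd_lt.
by rewrite mxE /= upd_eq G0 ?mul0r.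
Qed.

End LastRow.

Section TypeA.
Context {R : realType} (p : R[i]) (p0 : p != 0) (p1 : normc p < 1).
Implicit Types (x a : nat -> R[i]) (C t : R[i]) (P : nat -> R[i] -> R[i]).
Local Notation th := (theta p).

Definition tail_thetas n a (j : nat) t := \prod_(k < n | (j < k)%N) th (a k * t).

Definition typeA_det n a P x :=
  \det (\matrix_(i < n, j < n) (P j (x i) * tail_thetas n a j (x i))).

Definition typeA_vandermonde n x :=
  \prod_(j < n) \prod_(i < j) (x j * th (x i / x j)).

Definition typeA_denominator n C x :=
  th (C^-1 * \prod_(i < n) x i) * typeA_vandermonde n x.

Definition typeA_data n C a P := forall j, (j < n)%N ->
  theta_space p j.+1 (C * \prod_(k < n | (j < k)%N) a k)^-1 (P j).

Lemma theta_flip (x t : R[i]) : x != 0 -> t != 0 ->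
  t * th (x / t) = - x * th (x^-1 * t).
Proof.
move=> x0 t0; have -> : x / t = (x^-1 * t)^-1 by rewrite invfM invrK.
rewrite theta_inv // ?mulf_neq0 ?invr_eq0 //.
move: (th _) => v; rewrite mulrN mulNr; congr (- _).
by rewrite invfM invrK mulrC -!mulrA mulVf // mulr1 mulrC.
Qed.

Lemma theta_div_self (t : R[i]) : t != 0 -> th (t / t) = 0.
Proof. by move=> t0; rewrite divff // theta1. Qed.

Lemma typeA_entry_space n C a P j : (forall i, a i != 0) -> typeA_data n C a P ->
  (j < n)%N ->
  theta_space p n C^-1 (fun t => P j t * tail_thetas n a j t).
Proof.
move=> a0 hP jn.
have hT : theta_space p (\sum_(k < n | (j < k)%N) 1) (\prod_(k < n | (j < k)%N) a k)
    (tail_thetas n a j).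
  exact: (@theta_space_prod R p _ (index_enum 'I_n) (fun k => (j < k)%N) (fun=> 1%N)
    (fun k => a k) (fun k t => th (a k * t)) (fun k _ => theta_space_theta p0 p1 (a0 k))).
have := theta_spaceM (hP j jn) hT.
have -> : (j.+1 + \sum_(k < n | (j < k)%N) 1 = n)%N.
  have := @big_geq_mkord _ 0%N addn j.+1 n xpredT (fun=> 1%N).
  by rewrite /= => <-; rewrite sum_nat_const_nat muln1 subnKC.
by rewrite invfM mulfVK //; apply/prodf_neq0.
Qed.

Lemma vandermonde_upd n x t : typeA_vandermonde n.+1 (upd x n t) =
  typeA_vandermonde n x * \prod_(i < n) (t * th (x i / t)).
Proof.
rewrite /typeA_vandermonde big_ord_recr /= upd_eq; congr (_ * _).
  apply: eq_bigr => j _; apply: eq_bigr => i _.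
  by rewrite upd_lt // upd_lt // (ltn_trans (ltn_ord i)).
by apply: eq_bigr => i _; rewrite upd_lt.
Qed.

Lemma prod_upd n x t : \prod_(i < n.+1) upd x n t i = \prod_(i < n) x i * t.
Proof.
rewrite big_ord_recr /= upd_eq; congr (_ * _).
by apply: eq_bigr => i _; rewrite upd_lt.
Qed.

Lemma denominator_space n C x : C != 0 -> (forall i, x i != 0) ->
  theta_space p n.+1 C^-1 (fun t => typeA_denominator n.+1 C (upd x n t)).
Proof.
move=> C0 x0; pose b := C^-1 * \prod_(i < n) x i.
have b0 : b != 0 by rewrite mulf_neq0 ?invr_eq0 //; apply/prodf_neq0.
have hT := @theta_space_prod R p _ (index_enum 'I_n) xpredT (fun=> 1%N)
  (fun i => (x i)^-1) (fun i t => th ((x i)^-1 * t))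
  (fun i _ => theta_space_theta p0 p1 (invr_neq0 (x0 i))).
rewrite sum1_card card_ord prodfV in hT.
have H := theta_spaceZ (typeA_vandermonde n x * \prod_(i < n) (- x i))
  (theta_spaceM (theta_space_theta p0 p1 b0) hT).
rewrite /b mulfK in H; last by apply/prodf_neq0.
apply: (theta_space_ext p0 _ H) => t t0.
rewrite /typeA_denominator vandermonde_upd prod_upd (mulrA C^-1).
have -> : \prod_(i < n) (t * th (x i / t))
    = \prod_(i < n) (- x i) * \prod_(i < n) th ((x i)^-1 * t).
  by rewrite -big_split; apply: eq_bigr => i _; rewrite theta_flip.
move: (th (_ * t)) (typeA_vandermonde n x) (\prod_(i < n) - x i)
  (\prod_(i < n) th ((x i)^-1 * t)) => u v w z.
by ring.
Qed.

Lemma det_row_space n (G : nat -> R[i] -> R[i]) x m s : s != 0 ->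
  (forall j, (j < n.+1)%N -> theta_space p m s (G j)) ->
  theta_space p m s (fun t => \det (\matrix_(i < n.+1, j < n.+1) G j (upd x n t i))).
Proof.
move=> s0 hG; have [cof cofE] := det_last_row n G x.
have -> : (fun t => \det (\matrix_(i < n.+1, j < n.+1) G j (upd x n t i)))
   = fun t => \sum_(j < n.+1) cof j * G j t.
  by apply/funext => t; rewrite cofE; apply: eq_bigr => j _; rewrite mulrC.
by apply: theta_space_sum => // j; apply: theta_spaceZ; exact: hG.
Qed.

Definition typeA_formula n C a P x :=
  th (C * \prod_(i < n) a i)^-1 * typeA_det n a P x =
  \prod_(i < n) P i (a i)^-1 * \prod_(i < n) a i ^+ i * typeA_denominator n C x.

Lemma typeA_step_alg (F : fieldType) n (al A D pr Pp Pn pa t1 v w z : F) : al != 0 ->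
  A * D = Pp * pa * (t1 * v) ->
  A * (Pn * (w * D)) - Pp * Pn * (pa * al ^+ n) * (t1 * (v * (al^-1 ^+ n * w))) = 0.
Proof.
move=> al0 H; have -> : A * (Pn * (w * D)) = (A * D) * (Pn * w) by ring.
by rewrite H exprVn; field; exact: expf_neq0.
Qed.

(** At [1 / a_n] only the last entry of the last row survives, and the minor
    next to it is the determinant of smaller size with [C] replaced by
    [C a_n]. *)
Lemma typeA_corner n C a P x : (forall i, a i != 0) -> (forall i, x i != 0) ->
  typeA_formula n (C * a n) a P x ->
  typeA_formula n.+1 C a P (upd x n (a n)^-1).
Proof.
move=> a0 x0 IH; apply/eqP; rewrite -subr_eq0; apply/eqP.
have -> : typeA_det n.+1 a P (upd x n (a n)^-1) = P n (a n)^-1 *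
    (\prod_(i < n) th (x i / (a n)^-1) * typeA_det n a P x).
  rewrite /typeA_det.
  rewrite (@det_last_row_corner _ n (fun j t => P j t * tail_thetas n.+1 a j t)).
    have -> : tail_thetas n.+1 a n (a n)^-1 = 1.
      rewrite /tail_thetas big1 // => k; rewrite ltnNge -ltnS.
      by rewrite ltn_ord.
    rewrite mulr1; congr (_ * _); rewrite -det_scale_rows; congr (\det _).
    apply/matrixP => i j; rewrite !mxE mulrCA; congr (_ * _).
    rewrite /tail_thetas big_mkcond big_ord_recr /= ltn_ord -big_mkcond.
    by rewrite mulrC invrK (mulrC (x i)).
  move=> j jn; rewrite /tail_thetas big_mkcond big_ord_recr /= jn divff // theta1 //.
  by rewrite !mulr0.
have -> : typeA_denominator n.+1 C (upd x n (a n)^-1) =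
    th (C^-1 * (\prod_(i < n) x i / a n)) *
      (typeA_vandermonde n x * ((a n)^-1 ^+ n * \prod_(i < n) th (x i / (a n)^-1))).
  rewrite /typeA_denominator vandermonde_upd prod_upd.
  by rewrite big_split /= prodr_const card_ord.
rewrite !(big_ord_recr n) /=.
have -> : C * (\prod_(i < n) a i * a n) = C * a n * \prod_(i < n) a i.
  by rewrite -mulrA (mulrC (a n)).
have -> : C^-1 * (\prod_(i < n) x i / a n) = (C * a n)^-1 * \prod_(i < n) x i.
  by rewrite invfM mulrCA mulrC mulrAC.
apply: typeA_step_alg => //; exact: IH.
Qed.

(** Interpolation in the last variable, when the other variables and [1 / a_n]
    are in general position. *)
Lemma typeA_step n C a P x : C != 0 -> (forall i, a i != 0) ->
  (forall i, x i != 0) -> typeA_data n.+1 C a P ->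
  typeA_formula n (C * a n) a P x ->
  (forall i j : 'I_n.+1, i != j ->
    th (upd x n (a n)^-1 i / upd x n (a n)^-1 j) != 0) ->
  th (C^-1 * \prod_(i < n.+1) upd x n (a n)^-1 i) != 0 ->
  typeA_formula n.+1 C a P x.
Proof.
move=> C0 a0 x0 hP IH yij sy.
set K := \prod_(i < n.+1) P i (a i)^-1 * \prod_(i < n.+1) a i ^+ i.
set A := th (C * \prod_(i < n.+1) a i)^-1.
pose G j t := P j t * tail_thetas n.+1 a j t.
pose phi t := A * typeA_det n.+1 a P (upd x n t) - K * typeA_denominator n.+1 C (upd x n t).
have hG j : (j < n.+1)%N -> theta_space p n.+1 C^-1 (G j).
  by move=> jn; exact: typeA_entry_space.
have hphi : theta_space p #|'I_n.+1| C^-1 phi.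
  rewrite card_ord; apply: theta_spaceB.
    exact: (theta_spaceZ A (det_row_space x (invr_neq0 C0) hG)).
  exact: (theta_spaceZ K (denominator_space n C0 x0)).
have y0 (i : 'I_n.+1) : upd x n (a n)^-1 i != 0.
  by rewrite /upd; case: ifP => // _; rewrite invr_eq0.
have phi0 (i : 'I_n.+1) : phi (upd x n (a n)^-1 i) = 0.
  have [ilt|] := ltnP i n; last first.
    move=> ni; have -> : (i : nat) = n by apply/eqP; rewrite eqn_leq ni -ltnS ltn_ord.
    rewrite upd_eq /phi; apply/eqP; rewrite subr_eq0; apply/eqP.
    exact: typeA_corner.
  rewrite upd_lt // /phi.
  have -> : typeA_det n.+1 a P (upd x n (x i)) = 0.
    exact: (det_last_row_repeat G x ilt).
  rewrite /typeA_denominator vandermonde_upd (bigD1 (Ordinal ilt)) //=.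
  by rewrite theta_div_self // !(mulr0, mul0r) subrr.
have := theta_space_vanish p0 p1 hphi y0 yij sy phi0 (x0 n).
by rewrite /phi upd_id => /eqP; rewrite subr_eq0 => /eqP.
Qed.

Lemma ccont_punctured_comp (F : R[i] -> R[i]) (g : R[i] -> R[i]) (z : R[i]) :
  (forall y, y != 0 -> exists d, cderiv F y d) -> g z != 0 -> ccont g z ->
  ccont (fun w => F (g w)) z.
Proof.
move=> dF gz cg; apply: (@ccont_comp _ F g); first exact: cg.
by have [d /cderiv_cont] := dF _ gz.
Qed.

Lemma ccont_denominator n (X : R[i] -> nat -> R[i]) (C : R[i] -> R[i]) z :
  C z != 0 -> ccont C z -> (forall i, X z i != 0) ->
  (forall i, ccont (fun t => X t i) z) ->
  ccont (fun t => typeA_denominator n (C t) (X t)) z.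
Proof.
move=> C0 cC X0 cX; rewrite /typeA_denominator /typeA_vandermonde.
apply: ccontM.
  apply: (ccont_theta_comp p1 (g := fun t => (C t)^-1 * \prod_(i < n) X t i)).
    by rewrite mulf_neq0 ?invr_eq0 //; apply/prodf_neq0.
  apply: ccontM; first by apply: ccontV; [exact: C0|exact: cC].
  by apply: ccont_prod => i _; exact: cX.
apply: ccont_prod => j _; apply: ccont_prod => i _; apply: ccontM; first exact: cX.
apply: (ccont_theta_comp p1 (g := fun t => X t i / X t j)); first by rewrite mulf_neq0 ?invr_eq0.
by apply: ccontM; [exact: cX|apply: ccontV; [exact: X0|exact: cX]].
Qed.

(** Passing to the smaller size replaces [C] by [C a_n] and so preserves the
    product of [C] and all the [a_i], whose theta value is a factor of the
    formula. *)
Theorem typeA_determinant n C a P x : C != 0 -> (forall i, a i != 0) ->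
  (forall i, x i != 0) -> typeA_data n C a P ->
  th (C * \prod_(i < n) a i)^-1 != 0 -> typeA_formula n C a P x.
Proof.
move=> + a0 + + +; elim: n C x => [|n IH] C x C0 x0 hP hA.
  rewrite /typeA_formula /typeA_det /typeA_denominator /typeA_vandermonde.
  by rewrite det_mx00 !big_ord0 !mulr1 !mul1r.
have an0 := a0 n; have Can0 : C * a n != 0 by rewrite mulf_neq0.
have hPn : typeA_data n (C * a n) a P.
  move=> j jn; have := hP j (ltnW jn).
  rewrite (big_mkcond _ (fun k : 'I_n.+1 => _)) big_ord_recr /= jn.
  by rewrite -big_mkcond /= -mulrA (mulrC (a n)).
have hAn : th (C * a n * \prod_(i < n) a i)^-1 != 0.
  by move: hA; rewrite big_ord_recr /= -mulrA (mulrC (a n)).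
case: n IH hP hA an0 Can0 hPn hAn => [|n] IH hP hA an0 Can0 hPn hAn.
  apply: typeA_step => //; first exact: IH.
    by move=> i j; rewrite !ord1 eqxx.
  by move: hA; rewrite !big_ord_recl !big_ord0 /= !mulr1 invfM.
set N := n.+1 in IH hP hA an0 Can0 hPn hAn *.
(* the interpolation point [1 / a_N] must not move, so it gets speed 0 *)
pose nu (i : nat) : R[i] := if i == N then 0 else i.+1%:R.
pose X t (i : nat) := flow (x i) (nu i) t.
have X0 t i : X t i != 0 by exact: flow_neq0.
have XE : X 0 = x by apply/funext => i; exact: flow0.
have nuI : injective (fun i : 'I_N.+1 => nu i).
  move=> i j; rewrite /nu; case: eqP => [iN|_]; case: eqP => [jN|_].
  - by move=> _; apply: val_inj; rewrite /= iN jN.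
  - by move=> /esym/eqP; rewrite pnatr_eq0.
  - by move=> /eqP; rewrite pnatr_eq0.
  - by move=> /eqP; rewrite eqr_nat eqSS => /eqP ij; exact: val_inj.
have nus : \sum_(i < N.+1) nu i != 0.
  rewrite big_ord_recr /= /nu eqxx addr0.
  have -> : \sum_(i < N) (if (i : nat) == N then 0 else i.+1%:R)
      = (\sum_(i < N) i.+1)%:R :> R[i].
    by rewrite natr_sum; apply: eq_bigr => i _; rewrite ltn_eqF.
  by rewrite pnatr_eq0 /N big_ord_recl.
have y0 (i : 'I_N.+1) : upd x N (a N)^-1 i != 0.
  by rewrite /upd; case: ifP => // _; rewrite invr_eq0.
have gen := near0_generic_points p0 p1 (invr_neq0 C0) y0 nuI nus.
have XN t (i : nat) : flow (upd x N (a N)^-1 i) (nu i) t = upd (X t) N (a N)^-1 i.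
  rewrite /upd /X /nu; case: ifP => // iN.
  by rewrite /flow mul0r cexp0 mulr1.
have cX i : ccont (fun t => X t i) 0 by exact: ccont_flow.
rewrite -XE; apply: (@near0_eq _
  (fun t => th (C * \prod_(i < N.+1) a i)^-1 * typeA_det N.+1 a P (X t))
  (fun t => \prod_(i < N.+1) P i (a i)^-1 * \prod_(i < N.+1) a i ^+ i *
     typeA_denominator N.+1 C (X t))).
- apply: ccontM; first exact: ccont_cst.
  apply: ccont_det => i j.
  have [_ dF _] := typeA_entry_space a0 hP (ltn_ord j).
  rewrite (_ : (fun w => _) = fun w => (fun t => P j t * tail_thetas N.+1 a j t) (X w i)).
    exact: (ccont_punctured_comp dF (X0 0 i) (cX i)).
  by apply/funext => w; rewrite mxE.
- apply: ccontM; first exact: ccont_cst.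
  by apply: ccont_denominator => //; exact: ccont_cst.
have [d d0 H] := gen; exists d => // t td t0.
have [H1 H2] := H t td t0.
apply: (typeA_step C0 a0 (X0 t) hP); first exact: IH.
  by move=> i j ij; rewrite -!XN; exact: H1.
have -> : \prod_(i < N.+1) upd (X t) N (a N)^-1 i
    = \prod_(i < N.+1) flow (upd x N (a N)^-1 i) (nu i) t.
  by apply: eq_bigr => i _; rewrite XN.
exact: H2.
Qed.

End TypeA.

(** * Folding under inversion *)

Section SignSums.
Context {K : comNzRingType}.

(** The sum of [Phi] over all sign patterns below [n], one coordinate at a
    time; the coordinates from [n] on are read in [e]. *)
Fixpoint signsum n (Phi : (nat -> bool) -> K) (e : nat -> bool) : K :=
  if n is k.+1 then signsum k Phi (upd e k true) + signsum k Phi (upd e k false)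
  else Phi e.

Lemma signsumS n (Phi : (nat -> bool) -> K) e : signsum n.+1 Phi e =
  signsum n Phi (upd e n true) + signsum n Phi (upd e n false).
Proof. by []. Qed.

(** Two sums may be compared although they start from different patterns; this
    lets the last sign be frozen in one of them. *)
Lemma eq_signsum n (Phi Psi : (nat -> bool) -> K) e e' :
  (forall f f', (forall i, (i < n)%N -> f i = f' i) ->
     (forall i, (n <= i)%N -> f i = e i) -> (forall i, (n <= i)%N -> f' i = e' i) ->
     Phi f = Psi f') ->
  signsum n Phi e = signsum n Psi e'.
Proof.
elim: n e e' => [|n IH] e e' H /=; first exact: H.
suff step b : signsum n Phi (upd e n b) = signsum n Psi (upd e' n b) by rewrite !step.
apply: IH => f f' ff fe fe'; apply: H => i.
- rewrite ltnS leq_eqVlt => /orP[/eqP ->|]; last exact: ff.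
  by rewrite fe // fe' // !upd_eq.
- by move=> ni; rewrite fe ?(ltnW ni) // /upd gtn_eqF.
- by move=> ni; rewrite fe' ?(ltnW ni) // /upd gtn_eqF.
Qed.

Lemma signsumZ n k (Phi : (nat -> bool) -> K) e :
  signsum n (fun f => k * Phi f) e = k * signsum n Phi e.
Proof. by elim: n e => [//|n IH] e /=; rewrite !IH mulrDr. Qed.

Lemma signsum_sum (I : Type) (r : seq I) n (Phi : I -> (nat -> bool) -> K) e :
  \sum_(i <- r) signsum n (Phi i) e = signsum n (fun f => \sum_(i <- r) Phi i f) e.
Proof. by elim: n e => [//|n IH] e /=; rewrite big_split /= !IH. Qed.

Lemma prod_signsum n (g : 'I_n -> bool -> K) e :
  \prod_(i < n) (g i true + g i false) = signsum n (fun f => \prod_(i < n) g i (f i)) e.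
Proof.
elim: n g e => [|n IH] g e; first by rewrite /= !big_ord0.
rewrite big_ord_recr /= mulrDr.
suff step b : (\prod_(i < n) (g (widen_ord (leqnSn n) i) true + g (widen_ord (leqnSn n) i) false))
    * g ord_max b = signsum n (fun f => \prod_(i < n.+1) g i (f i)) (upd e n b).
  by rewrite !step.
rewrite (IH (fun i => g (widen_ord (leqnSn n) i)) (upd e n b)) mulrC -signsumZ.
apply: eq_signsum => f f' ff _ fe; rewrite big_ord_recr /= fe // upd_eq mulrC.
by congr (_ * _); apply: eq_bigr => i _; rewrite -ff.
Qed.

Lemma det_signsum n (u : nat -> bool -> K) (A : nat -> bool -> nat -> K) e :
  \det (\matrix_(i < n, j < n) (u i true * A i true j + u i false * A i false j)) =
  signsum n (fun f => \prod_(i < n) u i (f i) *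
                      \det (\matrix_(i < n, j < n) A i (f i) j)) e.
Proof.
have -> : (fun f : nat -> bool => \prod_(i < n) u i (f i) *
      \det (\matrix_(i < n, j < n) A i (f i) j)) =
    fun f => \sum_(s : 'S_n) (-1) ^+ s * \prod_(i < n) (u i (f i) * A i (f i) (s i)).
  apply/funext => f; rewrite /determinant mulr_sumr; apply: eq_bigr => s _.
  rewrite big_split /= mulrCA; congr (_ * (_ * _)).
  by apply: eq_bigr => i _; rewrite mxE.
rewrite -signsum_sum /determinant; apply: eq_bigr => s _.
rewrite signsumZ -(prod_signsum (fun i b => u i b * A i b (s i))); congr (_ * _).
by apply: eq_bigr => i _; rewrite mxE.
Qed.

End SignSums.

Section TypeB.
Context {R : realType} (p : R[i]) (p0 : p != 0) (p1 : normc p < 1).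
Implicit Types (x a c : nat -> R[i]) (C s t d : R[i]) (P : nat -> R[i] -> R[i]).
Local Notation th := (theta p).

Definition inv_if t (b : bool) : R[i] := if b then t else t^-1.

(** The weights of [F_j(t)] and [F_j(1/t)] in an entry of the matrix, for [m]
    parameters [c] and a matrix of size [m + 1]. *)
Definition fold_coef m c t (b : bool) : R[i] :=
  if b then t ^- m * \prod_(k < m) th (c k * t)
  else - (t ^+ m.+1 * \prod_(k < m) th (c k * t^-1)).

Definition fold_fun m c (F : R[i] -> R[i]) t : R[i] :=
  fold_coef m c t true * F t + fold_coef m c t false * F t^-1.

Definition fold_det m c a P x :=
  \det (\matrix_(i < m.+1, j < m.+1)
    fold_fun m c (fun t => P j t * tail_thetas p m.+1 a j t) (x i)).

Definition fold_sum m c x :=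
  signsum m.+1 (fun e => \prod_(i < m.+1) fold_coef m c (x i) (e i) *
    typeA_denominator p m.+1 (\prod_(k < m) c k) (fun i => inv_if (x i) (e i)))
    (fun=> true).

Definition typeB_denominator m c x : R[i] :=
  2 * \prod_(k < m) (th (- c k) * theta (p ^+ 2) (p * c k ^+ 2))
    * \prod_(j < m) \prod_(i < j) th (c i * c j)
    * \prod_(i < m.+1) th (x i)
    * \prod_(j < m.+1) \prod_(i < j) ((x i)^-1 * theta_pm p (x i) (x j)).

Lemma inv_if_neq0 t b : t != 0 -> inv_if t b != 0.
Proof. by case: b => //=; rewrite invr_eq0. Qed.

(** The data [a] and [P] come out of the sum as a common factor. *)
Lemma fold_det_sum m c a P x : (forall i, a i != 0) -> (forall i, x i != 0) ->
  (forall i, c i != 0) -> typeA_data p m.+1 (\prod_(k < m) c k) a P ->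
  th ((\prod_(k < m) c k) * \prod_(i < m.+1) a i)^-1 != 0 ->
  th ((\prod_(k < m) c k) * \prod_(i < m.+1) a i)^-1 * fold_det m c a P x =
  \prod_(i < m.+1) P i (a i)^-1 * \prod_(i < m.+1) a i ^+ i * fold_sum m c x.
Proof.
move=> a0 x0 c0 hP hA; have C0 : \prod_(k < m) c k != 0 by apply/prodf_neq0.
rewrite /fold_det /fold_fun (det_signsum m.+1 (fun i b => fold_coef m c (x i) b)
  (fun i b j => P j (inv_if (x i) b) * tail_thetas p m.+1 a j (inv_if (x i) b))
  (fun=> true)).
rewrite -!signsumZ; apply: eq_signsum => f f' ff fe fe'.
have -> : f = f'.
  by apply/funext => i; case: (ltnP i m.+1) => [/ff//|im]; rewrite fe ?fe'.
have y0 i : inv_if (x i) (f' i) != 0 by exact: inv_if_neq0.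
have := typeA_determinant p0 p1 C0 a0 y0 hP hA; rewrite /typeA_formula /typeA_det => H.
by rewrite mulrCA H mulrCA.
Qed.

(** Some choice of [a] and [P] has a non-zero common factor; it allows to write
    [fold_sum] as a determinant, from which its zeros and its quasi-periodicity
    are read off. All the [a_i] are equal to some [al], and [P_j] is a product of
    [theta(- al u)], so that [theta(-1) != 0] takes care of [P_j(1 / al)]. *)
Lemma typeA_data_ex m C : C != 0 -> exists a P,
  [/\ forall i, a i != 0, typeA_data p m.+1 C a P,
      th (C * \prod_(i < m.+1) a i)^-1 != 0 &
      \prod_(i < m.+1) P i (a i)^-1 * \prod_(i < m.+1) a i ^+ i != 0].
Proof.
move=> C0; have m0 : - (m.+1%:R : R[i]) != 0 by rewrite oppr_eq0 pnatr_eq0.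
have Ci : C^-1 != 0 by rewrite invr_eq0.
have CNi : - C^-1 != 0 by rewrite oppr_eq0.
have [t [t1 t2]] := near0_ex (near0_and (near0_theta_neq0 p0 p1 Ci m0)
  (near0_theta_neq0 p0 p1 CNi m0)).
pose al : R[i] := cexp t; have al0 : al != 0 by exact: cexp_neq0.
have E : cexp (- m.+1%:R * t) = al ^- m.+1.
  by rewrite mulNr cexpN mulr_natl cexpMn.
rewrite /flow E in t1 t2.
(* the norm of the last factor is what makes the total norm of [P j] right *)
pose s j : R[i] := ((- al) ^+ j * (C * al ^+ (m - j)))^-1.
pose P (j : nat) (u : R[i]) := (\prod_(i < j) th (- al * u)) * th (s j * u).
have s0 j : s j != 0 by rewrite invr_eq0 !mulf_neq0 // expf_neq0 // oppr_eq0.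
exists (fun=> al), P; split => //.
- move=> j jm.
  have nal : - al != 0 by rewrite oppr_eq0.
  have hT := @theta_space_prod R p _ (index_enum 'I_j) xpredT (fun=> 1%N)
    (fun=> - al) (fun i u => th (- al * u)) (fun i _ => theta_space_theta p0 p1 nal).
  rewrite sum1_card card_ord prodr_const card_ord in hT.
  have := theta_spaceM hT (theta_space_theta p0 p1 (s0 j)).
  have -> : \prod_(k < m.+1 | (j < k)%N) al = al ^+ (m - j).
    have := @big_geq_mkord _ 1 *%R j.+1 m.+1 xpredT (fun=> al).
    by rewrite /= => <-; rewrite prodr_const_nat subSS.
  rewrite addn1; congr (theta_space p _ _ _).
  by rewrite /s invfM mulVKf // expf_neq0.
- by rewrite prodr_const card_ord invfM.
rewrite mulf_neq0 //; last by apply/prodf_neq0 => i _; rewrite expf_neq0.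
apply/prodf_neq0 => j _; rewrite /P mulf_neq0 //.
  by apply/prodf_neq0 => i _; rewrite mulNr divff // theta_N1_neq0.
have -> : s j / al = (-1) ^+ j * (C^-1 * al ^- m.+1).
  have -> : al ^+ m.+1 = al ^+ j * al ^+ (m - j) * al.
    by rewrite -exprD subnKC -?exprSr // -ltnS.
  by rewrite /s (exprNn al) !invfM invr_sign; ring.
by rewrite -signr_odd; case: (odd j); rewrite ?expr1 ?mulN1r -?mulNr // expr0 mul1r.
Qed.

Lemma fold_fun_inv m c F t : t != 0 -> fold_fun m c F t^-1 = - t^-1 * fold_fun m c F t.
Proof.
move=> t0; rewrite /fold_fun /fold_coef invrK.
move: (\prod_(k < m) th (c k * t)) (\prod_(k < m) th (c k * t^-1)) => u v.
move: (F t) (F t^-1) => f g; rewrite exprVn invrK.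
have -> : t^-1 ^+ m.+1 = t^-1 * t ^- m by rewrite exprS exprVn.
have -> : t ^+ m.+1 = t * t ^+ m by rewrite exprS.
have := expf_neq0 m t0; move: (t ^+ m) => B B0; field.
by apply/andP.
Qed.

Lemma fold_fun_space m c F : (forall k, c k != 0) ->
  theta_space p m.+1 (\prod_(k < m) c k)^-1 F ->
  theta_space p (m + m.+1) (p ^+ m) (fold_fun m c F).
Proof.
move=> c0 hF; have C0 : \prod_(k < m) c k != 0 by apply/prodf_neq0.
have hT := @theta_space_prod R p _ (index_enum 'I_m) xpredT (fun=> 1%N)
  (fun k => c k) (fun k t => th (c k * t)) (fun k _ => theta_space_theta p0 p1 (c0 k)).
rewrite sum1_card card_ord in hT.
have hG := theta_spaceM hT hF; rewrite divff // in hG.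
have hX := theta_space_inv p0 (theta_spaceX p0 m).
rewrite expr0 div1r invrK in hX.
have h1 := theta_spaceM hX hG; rewrite add0n mulr1 in h1.
have h2 := theta_spaceM (theta_spaceX p0 m.+1) (theta_space_inv p0 hG).
have e2 : p ^- m.+1 * (p ^+ (m + m.+1) / 1) = p ^+ m.
  by rewrite divr1 addnC exprD mulKf // expf_neq0.
rewrite add0n e2 in h2.
apply: (theta_space_ext p0 _ (theta_spaceB h1 h2)) => t t0.
by rewrite /fold_fun /fold_coef exprVn !mulNr !mulrA.
Qed.

Lemma fold_det_inv m c a P x t : t != 0 ->
  fold_det m c a P (upd x m t^-1) = - t^-1 * fold_det m c a P (upd x m t).
Proof.
move=> t0; rewrite /fold_det.
have [cof cofE] := @det_last_row _ m
  (fun j => fold_fun m c (fun t => P j t * tail_thetas p m.+1 a j t)) x.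
rewrite !cofE mulr_sumr; apply: eq_bigr => j _.
by rewrite fold_fun_inv // mulrA.
Qed.

Lemma typeB_denominator_upd m c x t : typeB_denominator m.+1 c (upd x m.+1 t) =
  2 * \prod_(k < m.+1) (th (- c k) * theta (p ^+ 2) (p * c k ^+ 2))
    * \prod_(j < m.+1) \prod_(i < j) th (c i * c j)
    * (\prod_(i < m.+1) th (x i) * th t)
    * (\prod_(j < m.+1) \prod_(i < j) ((x i)^-1 * theta_pm p (x i) (x j))
       * \prod_(i < m.+1) ((x i)^-1 * theta_pm p (x i) t)).
Proof.
rewrite /typeB_denominator (big_ord_recr m.+1) [in X in _ * X]big_ord_recr /= upd_eq.
congr (_ * (_ * th t) * (_ * _)).
- by apply: eq_bigr => i _; rewrite upd_lt.
- apply: eq_bigr => j _; apply: eq_bigr => i _.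
  by rewrite !upd_lt // (ltn_trans (ltn_ord i)).
- by apply: eq_bigr => i _; rewrite upd_lt.
Qed.

Lemma typeB_denominator_space m c x : (forall i, x i != 0) ->
  theta_space p (m.+1 + m.+2) (p ^+ m.+1)
    (fun t => typeB_denominator m.+1 c (upd x m.+1 t)).
Proof.
move=> x0.
have hX := theta_space_inv p0 (theta_spaceX p0 m.+1).
rewrite expr0 div1r invrK in hX.
have h1 := @theta_space_prod R p _ (index_enum 'I_m.+1) xpredT (fun=> 1%N)
  (fun k => x k) (fun k t => th (x k * t)) (fun k _ => theta_space_theta p0 p1 (x0 k)).
have h2 := @theta_space_prod R p _ (index_enum 'I_m.+1) xpredT (fun=> 1%N)
  (fun k => (x k)^-1) (fun k t => th ((x k)^-1 * t))
  (fun k _ => theta_space_theta p0 p1 (invr_neq0 (x0 k))).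
rewrite !sum1_card !card_ord prodfV in h1 h2.
have h3 := theta_spaceM hX (theta_spaceM (theta_space_theta p0 p1 (oner_neq0 _))
  (theta_spaceM h1 h2)).
rewrite divff in h3; last by apply/prodf_neq0.
rewrite !mulr1 add0n add1n -addnS in h3.
set k1 := 2 * \prod_(k < m.+1) (th (- c k) * theta (p ^+ 2) (p * c k ^+ 2))
    * \prod_(j < m.+1) \prod_(i < j) th (c i * c j).
set k2 := \prod_(j < m.+1) \prod_(i < j) ((x i)^-1 * theta_pm p (x i) (x j)).
have h4 := theta_spaceZ (k1 * (\prod_(i < m.+1) th (x i)) * k2 * (-1) ^+ m.+1) h3.
apply: (theta_space_ext p0 _ h4) => t t0; rewrite typeB_denominator_upd -/k1 -/k2 (mul1r t).
have -> : \prod_(i < m.+1) ((x i)^-1 * theta_pm p (x i) t) = (-1) ^+ m.+1 *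
   (t^-1 ^+ m.+1 * (\prod_(k < m.+1) th (x k * t) * \prod_(k < m.+1) th ((x k)^-1 * t))).
  have e i : (x i)^-1 * theta_pm p (x i) t = -1 * (t^-1 * (th (x i * t) * th ((x i)^-1 * t))).
    have := @theta_flip R p p0 p1 (x i) t (x0 i) t0; rewrite /theta_pm => H.
    have -> : th (x i / t) = t^-1 * (- x i * th ((x i)^-1 * t)) by rewrite -H mulKf.
    move: (th _) (th _) => u v; have := x0 i => xi0.
    by field; apply/andP.
  have -> : \prod_(i < m.+1) ((x i)^-1 * theta_pm p (x i) t) =
      \prod_(i < m.+1) (-1 * (t^-1 * (th (x i * t) * th ((x i)^-1 * t)))).
    by apply: eq_bigr => i _; exact: e.
  by rewrite !big_split /= !prodr_const !card_ord.
move: (th t) (t^-1 ^+ m.+1) ((-1) ^+ m.+1) (\prod_(i < m.+1) th (x i))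
  (\prod_(k < m.+1) th (x k * t)) (\prod_(k < m.+1) th ((x k)^-1 * t)) => u v w z y1 y2.
by ring.
Qed.

End TypeB.

Arguments fold_coef : simpl never.

(** * Evaluation of the folded sum *)

Section FoldIdentity.
Context {R : realType} (p : R[i]) (p0 : p != 0) (p1 : normc p < 1).
Implicit Types (x a c : nat -> R[i]) (C s t d : R[i]) (P : nat -> R[i] -> R[i]).
Local Notation th := (theta p).
Local Notation co := (fold_coef p).
Local Notation den := (typeB_denominator p).

Lemma theta_reflect t d : t != 0 -> d != 0 -> th (d * t^-1) = - (d * t^-1 * th (t / d)).
Proof.
move=> t0 d0; have -> : d * t^-1 = (t / d)^-1 by rewrite invfM invrK mulrC.
by rewrite theta_inv // ?mulf_neq0 ?invr_eq0 // [(t / d)^-1 * _]mulrC.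
Qed.

(** The left-hand side gathers what a variable contributes through [c_m]; apart
    from the weight of smaller size, it does not depend on the sign, because
    [t^-1 theta(t c_m) theta(t / c_m)] is invariant under [t -> 1/t]. *)
Lemma fold_coef_step m c t b : t != 0 -> c m != 0 ->
  co m.+1 c t b * (c m * th (inv_if t b / c m)) =
  c m * (t^-1 * (th (t * c m) * th (t / c m))) * co m c t b.
Proof.
move=> t0 d0; rewrite /fold_coef /inv_if; case: b; rewrite big_ord_recr /=.
  rewrite (mulrC (c m) t) [t ^+ m.+1]exprS.
  move: (\prod_(i < m) _) (th (t * c m)) (th (t / c m)) => u v w.
  have := expf_neq0 m t0; move: (t ^+ m) => B B0.
  by field; apply/andP.
rewrite theta_reflect //.
have -> : th (t^-1 / c m) = - (th (t * c m) / (t * c m)).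
  by rewrite -invfM theta_inv // mulf_neq0.
rewrite [t ^+ m.+2]exprS [t ^+ m.+1]exprS.
move: (\prod_(i < m) _) (th (t * c m)) (th (t / c m)) (t ^+ m) => u v w B.
by field; apply/andP.
Qed.

Lemma typeB_corner_alg (F : fieldType) m (d S pc qc pcc px pxx thd thNd th2 g : F) :
  d != 0 -> S = 2 * pc * pcc * px * pxx ->
  - ((d^-1) ^+ m.+2 * (qc * (thd * thNd * th2))) * (d ^+ m.+1 * g) * S =
  2 * (pc * (thNd * th2)) * (pcc * qc) * (px * - (thd / d)) * (pxx * g).
Proof.
move=> d0 ->; rewrite exprVn [d ^+ m.+2]exprS.
by have := expf_neq0 m.+1 d0; move: (d ^+ m.+1) => B B0; field; apply/andP.
Qed.

(** At [1 / c_m] the weight of the positive last sign vanishes. With the negative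
    one, the factors that contain [c_m] do not depend on the other signs
    ([fold_coef_step]), and the rest is the sum of smaller size. *)
Lemma fold_sum_corner m c x : (forall k, c k != 0) -> (forall i, x i != 0) ->
  fold_sum p m c x = den m c x ->
  fold_sum p m.+1 c (upd x m.+1 (c m)^-1) = den m.+1 c (upd x m.+1 (c m)^-1).
Proof.
move=> c0 x0 IH; set d := c m; have d0 : d != 0 := c0 m.
set g := \prod_(i < m.+1) ((x i)^-1 * (th (x i * d) * th (x i / d))).
rewrite /fold_sum signsumS.
set Phi := (fun e : nat -> bool => _).
have -> : signsum m.+1 Phi (upd (fun=> true) m.+1 true) = 0.
  rewrite -[RHS](mul0r (signsum m.+1 Phi (fun=> true))) -signsumZ.
  apply: eq_signsum => f f' _ fe _; rewrite /Phi big_ord_recr /= fe // upd_eq upd_eq.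
  have -> : co m.+1 c d^-1 true = 0.
    by rewrite /fold_coef big_ord_recr /= divff // theta1 // !mulr0.
  by rewrite mulr0 !mul0r.
have -> : signsum m.+1 Phi (upd (fun=> true) m.+1 false) =
    co m.+1 c d^-1 false * (d ^+ m.+1 * g) * fold_sum p m c x.
  rewrite -signsumZ; apply: eq_signsum => f f' ff fe _.
  rewrite /Phi big_ord_recr /= fe // !upd_eq.
  have -> : \prod_(i < m.+1) co m.+1 c (upd x m.+1 d^-1 i) (f i) =
      \prod_(i < m.+1) co m.+1 c (x i) (f' i).
    by apply: eq_bigr => i _; rewrite upd_lt // ff.
  pose y i := inv_if (x i) (f' i).
  have -> : typeA_denominator p m.+2 (\prod_(k < m.+1) c k)
        (fun i => inv_if (upd x m.+1 d^-1 i) (f i)) =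
      th ((\prod_(k < m) c k)^-1 * \prod_(i < m.+1) y i) *
        (typeA_vandermonde p m.+1 y * \prod_(i < m.+1) (d * th (y i / d))).
    have C0 : \prod_(k < m) c k != 0 by apply/prodf_neq0.
    have -> : (\prod_(k < m) c k)^-1 * \prod_(i < m.+1) y i =
        (\prod_(k < m.+1) c k)^-1 * (\prod_(i < m.+1) y i * d).
      have -> : \prod_(k < m.+1) c k = \prod_(k < m) c k * d by rewrite big_ord_recr.
      move: (\prod_(i < m) c i) (\prod_(i < m.+1) y i) C0 => A B A0.
      by field; apply/andP.
    rewrite -prod_upd -vandermonde_upd /typeA_denominator /typeA_vandermonde.
    have E i : (i < m.+2)%N -> inv_if (upd x m.+1 d^-1 i) (f i) = upd y m.+1 d i.
      rewrite ltnS leq_eqVlt => /orP[/eqP ->|im].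
        by rewrite !upd_eq fe // upd_eq /= invrK.
      by rewrite !upd_lt // ff.
    congr (th (_ * _) * _); first by apply: eq_bigr => i _; exact: E.
    apply: eq_bigr => j _; apply: eq_bigr => i _.
    by rewrite !E // (ltn_trans (ltn_ord i)).
  have step : \prod_(i < m.+1) co m.+1 c (x i) (f' i) * \prod_(i < m.+1) (d * th (y i / d))
      = (d ^+ m.+1 * g) * \prod_(i < m.+1) co m c (x i) (f' i).
    rewrite -big_split /=.
    have -> : d ^+ m.+1 = \prod_(i < m.+1) d by rewrite prodr_const card_ord.
    rewrite -!big_split /=; apply: eq_bigr => i _.
    exact: fold_coef_step.
  rewrite -[typeA_denominator p m.+1 _ _]/(th ((\prod_(k < m) c k)^-1 *
    \prod_(i < m.+1) y i) * typeA_vandermonde p m.+1 y).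
  move: step; move: (\prod_(i < m.+1) co m.+1 c (x i) (f' i))
    (\prod_(i < m.+1) (d * th (y i / d))) (\prod_(i < m.+1) co m c (x i) (f' i)).
  move=> u v w step.
  move: (co m.+1 c _ false) (d ^+ m.+1 * g) step => k1 k2 step.
  move: (th (_ * \prod_(i < m.+1) y i)) (typeA_vandermonde p m.+1 y) => t1 v1.
  transitivity (k1 * t1 * v1 * (u * v)); first by ring.
  by rewrite step; ring.
rewrite add0r typeB_denominator_upd.
have -> : co m.+1 c d^-1 false =
    - (d^-1 ^+ m.+2 * (\prod_(k < m) th (c k * d) * th (d * d))).
  by rewrite /fold_coef big_ord_recr /= invrK.
rewrite [\prod_(k < m.+1) (th (- c k) * _)]big_ord_recr /= -/d.
rewrite [\prod_(j < m.+1) \prod_(i < j) th (c i * c j)]big_ord_recr /= -/d.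
have -> : th (d * d) = th d * th (- d) * theta (p ^+ 2) (p * d ^+ 2).
  by rewrite -theta_sqr // expr2.
have -> : th d^-1 = - (th d / d) by rewrite theta_inv.
have -> : \prod_(i < m.+1) ((x i)^-1 * theta_pm p (x i) d^-1) = g.
  apply: eq_bigr => i _; congr (_ * _); rewrite /theta_pm invrK.
  by rewrite mulrC.
apply: typeB_corner_alg => //; exact: IH.
Qed.

(** The zeros used for interpolation in the last variable. *)
Definition corner_points m c x (u : 'I_m.+1 * bool + unit) : R[i] :=
  match u with inl ib => inv_if (x ib.1) ib.2 | inr _ => (c m)^-1 end.

Lemma fold_sum_step m c x : (forall k, c k != 0) -> (forall i, x i != 0) ->
  fold_sum p m c x = den m c x ->
  (forall u v : 'I_m.+1 * bool + unit, u != v ->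
     th (corner_points c x u / corner_points c x v) != 0) ->
  th (p ^+ m.+1 * \prod_(u : 'I_m.+1 * bool + unit) corner_points c x u) != 0 ->
  fold_sum p m.+1 c x = den m.+1 c x.
Proof.
move=> c0 x0 IH yuv sy.
have C0 : \prod_(k < m.+1) c k != 0 by apply/prodf_neq0.
have [a [P [a0 hP hA hK]]] := typeA_data_ex p0 p1 m.+1 C0.
move: hK; set K := _ * _ => K0.
set A := th (_)^-1 in hA.
have sumE y : (forall i, y i != 0) -> fold_sum p m.+1 c y = K^-1 * A * fold_det p m.+1 c a P y.
  move=> y0; rewrite -mulrA /A fold_det_sum // -/K mulKf //.
pose phi t := K^-1 * A * fold_det p m.+1 c a P (upd x m.+1 t) - den m.+1 c (upd x m.+1 t).
have hphi : theta_space p #|{: 'I_m.+1 * bool + unit}| (p ^+ m.+1) phi.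
  have -> : #|{: 'I_m.+1 * bool + unit}| = (m.+1 + m.+2)%N.
    by rewrite card_sum card_prod card_bool card_unit card_ord muln2 -addnn addn1 -addnS.
  apply: theta_spaceB; last exact: typeB_denominator_space.
  apply: theta_spaceZ; apply: (det_row_space (G := fun j =>
      fold_fun p m.+1 c (fun t => P j t * tail_thetas p m.+2 a j t))).
    by rewrite expf_neq0.
  by move=> j jm; apply: fold_fun_space => //; exact: typeA_entry_space.
have y0 (u : 'I_m.+1 * bool + unit) : corner_points c x u != 0.
  by case: u => [[i b]|[]] /=; [exact: inv_if_neq0|rewrite invr_eq0].
have X0 t : t != 0 -> forall i, upd x m.+1 t i != 0.
  by move=> t0 i; rewrite /upd; case: ifP.
have rep (i : 'I_m.+1) : fold_det p m.+1 c a P (upd x m.+1 (x i)) = 0.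
  exact: (@det_last_row_repeat _ m.+1
    (fun j => fold_fun p m.+1 c (fun t => P j t * tail_thetas p m.+2 a j t)) x i).
have den0 (i : 'I_m.+1) b : den m.+1 c (upd x m.+1 (inv_if (x i) b)) = 0.
  rewrite typeB_denominator_upd.
  have -> : \prod_(j < m.+1) ((x j)^-1 * theta_pm p (x j) (inv_if (x i) b)) = 0.
    rewrite (bigD1 i) //= /theta_pm.
    by case: b => /=; rewrite theta_div_self // !(mulr0, mul0r).
  by rewrite !mulr0.
have phi0 (u : 'I_m.+1 * bool + unit) : phi (corner_points c x u) = 0.
  case: u => [[i b]|[]].
    rewrite -[corner_points _ _ _]/(inv_if (x i) b) /phi (den0 i b) subr0.
    case: b => /=; first by rewrite rep mulr0.
    by rewrite fold_det_inv // rep !mulr0.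
  rewrite -[corner_points _ _ _]/(c m)^-1 /phi -sumE; last by apply: X0; rewrite invr_eq0.
  by rewrite fold_sum_corner // subrr.
have := theta_space_vanish p0 p1 hphi y0 yuv sy phi0 (x0 m.+1).
by rewrite /phi upd_id -sumE // => /eqP; rewrite subr_eq0 => /eqP.
Qed.

Lemma ccont_signsum n (Phi : R[i] -> (nat -> bool) -> R[i]) e (z : R[i]) :
  (forall f, ccont (fun w => Phi w f) z) -> ccont (fun w => signsum n (Phi w) e) z.
Proof.
by move=> H; elim: n e => [|n IH] e; [exact: H|apply: ccontD; exact: IH].
Qed.

Section Continuity.
Context (X Y : R[i] -> nat -> R[i]) (z : R[i]).
Context (X0 : forall i, X z i != 0) (Y0 : forall i, Y z i != 0)
  (cX : forall i, ccont (fun t => X t i) z) (cY : forall i, ccont (fun t => Y t i) z).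

Lemma ccont_inv_if i b : ccont (fun t => inv_if (X t i) b) z.
Proof. by case: b; [exact: cX|apply: ccontV; [exact: X0|exact: cX]]. Qed.

Lemma ccont_fold_coef m i b : ccont (fun t => co m (Y t) (X t i) b) z.
Proof.
have cV : ccont (fun t => (X t i)^-1) z by apply: ccontV; [exact: X0|exact: cX].
have V0 : (X z i)^-1 != 0 by rewrite invr_eq0.
case: b; rewrite /fold_coef.
  apply: ccontM.
    by apply: ccontV; [rewrite expf_neq0|apply: ccontX; exact: cX].
  apply: ccont_prod => k _; apply: (ccont_theta_comp p1 (g := fun t => Y t k * X t i)).
    by rewrite mulf_neq0.
  by apply: ccontM; [exact: cY|exact: cX].
apply: ccontN; apply: ccontM; first by apply: ccontX; exact: cX.
apply: ccont_prod => k _; apply: (ccont_theta_comp p1 (g := fun t => Y t k * (X t i)^-1)).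
  by rewrite mulf_neq0.
by apply: ccontM; [exact: cY|exact: cV].
Qed.

Lemma ccont_fold_sum m : ccont (fun t => fold_sum p m (Y t) (X t)) z.
Proof.
apply: ccont_signsum => f; apply: ccontM.
  by apply: ccont_prod => i _; exact: ccont_fold_coef.
apply: (ccont_denominator p1 (n := m.+1) (X := fun t i => inv_if (X t i) (f i))
  (C := fun t => \prod_(k < m) Y t k)).
- by apply/prodf_neq0.
- by apply: ccont_prod => k _; exact: cY.
- by move=> i; exact: inv_if_neq0.
- by move=> i; exact: ccont_inv_if.
Qed.

Lemma ccont_typeB_denominator m : ccont (fun t => den m (Y t) (X t)) z.
Proof.
have cV i : ccont (fun t => (X t i)^-1) z by apply: ccontV; [exact: X0|exact: cX].
have V0 i : (X z i)^-1 != 0 by rewrite invr_eq0.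
have p20 : p ^+ 2 != 0 by rewrite expf_neq0.
rewrite /typeB_denominator; apply: ccontM; first (apply: ccontM; first (apply: ccontM;
  first (apply: ccontM; first exact: ccont_cst))).
- apply: ccont_prod => k _; apply: ccontM.
    apply: (ccont_theta_comp p1 (g := fun t => - Y t k)).
      by rewrite oppr_eq0.
    by apply: ccontN; exact: cY.
  apply: (ccont_theta_comp (p2_lt1 p1) (g := fun t => p * Y t k ^+ 2)).
    by rewrite mulf_neq0 // expf_neq0.
  by apply: ccontM; [exact: ccont_cst|apply: ccontX; exact: cY].
- apply: ccont_prod => j _; apply: ccont_prod => i _.
  apply: (ccont_theta_comp p1 (g := fun t => Y t i * Y t j)); first by rewrite mulf_neq0.
  by apply: ccontM; exact: cY.
- apply: ccont_prod => i _; apply: (ccont_theta_comp p1 (g := fun t => X t i)); first exact: X0.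
  exact: cX.
apply: ccont_prod => j _; apply: ccont_prod => i _; apply: ccontM; first exact: cV.
apply: ccontM.
  apply: (ccont_theta_comp p1 (g := fun t => X t i * X t j)); first by rewrite mulf_neq0.
  by apply: ccontM; exact: cX.
apply: (ccont_theta_comp p1 (g := fun t => X t i / X t j)); first by rewrite mulf_neq0.
by apply: ccontM; [exact: cX|exact: cV].
Qed.

End Continuity.

(** Here [c_m] has to move as well as the [x_i]; the sum over the sign patterns
    remains meaningful when [c] varies, unlike the functions [P_j], whose norms
    are tied to [c]. *)
Theorem fold_sum_eval m c x : (forall k, c k != 0) -> (forall i, x i != 0) ->
  fold_sum p m c x = den m c x.
Proof.
elim: m c x => [|m IH] c x c0 x0.
  have W y : typeA_denominator p 1 (\prod_(k < 0) c k) y = th (y 0%N).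
    rewrite /typeA_denominator /typeA_vandermonde !big_ord1 !big_ord0.
    by rewrite invr1 mul1r mulr1.
  have coT : co 0 c (x 0%N) true = 1.
    by rewrite /fold_coef big_ord0 expr0 invr1 mulr1.
  have coF : co 0 c (x 0%N) false = - x 0%N.
    by rewrite /fold_coef big_ord0 expr1 mulr1.
  have -> : den 0 c x = 2 * th (x 0%N).
    by rewrite /typeB_denominator !big_ord1 !big_ord0 !mulr1.
  rewrite /fold_sum signsumS /= !big_ord1 !upd_eq !W !upd_eq /inv_if coT coF mul1r.
  rewrite theta_inv // mulNr mulrN opprK mulrC divfK //.
  by rewrite -mulr2n mulr_natl.
pose nu (u : 'I_m.+1 * bool + unit) : R[i] :=
  match u with
  | inl ib => if ib.2 then ib.1.+1%:R else - ib.1.+1%:R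
  | inr _ => - m.+2%:R
  end.
have nuI : injective nu.
  have posneg (k l : nat) : k.+1%:R = - l.+1%:R :> R[i] -> False.
    by move=> /eqP; rewrite -subr_eq0 opprK -natrD pnatr_eq0.
  have lt_neq (i : 'I_m.+1) : i.+1%:R = m.+2%:R :> R[i] -> False.
    by move=> /eqP; rewrite eqr_nat eqSS ltn_eqF.
  move=> [[i b]|[]] [[j b']|[]] //=.
  - case: b; case: b' => /eqP; rewrite ?eqr_opp ?eqr_nat ?eqSS.
    + by move=> /eqP/val_inj ->.
    + by move=> /eqP/posneg.
    + by rewrite eq_sym => /eqP/posneg.
    + by move=> /eqP/val_inj ->.
  - by case: b => [/posneg|/oppr_inj/lt_neq].
  - by case: b' => [/esym/posneg|/oppr_inj/esym/lt_neq].
have nus : \sum_u nu u != 0.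
  rewrite big_sumType /= -(pair_bigA _ (fun i b => nu (inl (i, b)))) /=.
  rewrite big1 => [|i _]; last by rewrite big_bool /= subrr.
  by rewrite add0r (big_pred1 tt) => [|[]//]; rewrite oppr_eq0 pnatr_eq0.
pose X t (i : nat) := flow (x i) i.+1%:R t.
pose Y t (k : nat) := flow (c k) (if k == m then m.+2%:R else 0) t.
have X0 t i : X t i != 0 by exact: flow_neq0.
have Y0 t k : Y t k != 0 by exact: flow_neq0.
have XE : X 0 = x by apply/funext => i; exact: flow0.
have YE : Y 0 = c by apply/funext => i; exact: flow0.
have y0 u : corner_points (m := m) c x u != 0.
  by case: u => [[i b]|[]] /=; [exact: inv_if_neq0|rewrite invr_eq0].
have pm0 : p ^+ m.+1 != 0 by rewrite expf_neq0.
have gen := near0_generic_points p0 p1 pm0 y0 nuI nus.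
have cpE t u : flow (corner_points (m := m) c x u) (nu u) t = corner_points (Y t) (X t) u.
  case: u => [[i b]|[]] /=; last by rewrite /Y eqxx flowV.
  by case: b => //=; rewrite /X flowV.
rewrite -XE -YE; apply: (@near0_eq _
  (fun t => fold_sum p m.+1 (Y t) (X t)) (fun t => den m.+1 (Y t) (X t))).
- by apply: ccont_fold_sum => // i; exact: ccont_flow.
- by apply: ccont_typeB_denominator => // i; exact: ccont_flow.
have [d d0 H] := gen; exists d => // t td t0.
have [H1 H2] := H t td t0.
apply: (fold_sum_step (Y0 t) (X0 t)); first exact: IH.
  by move=> u v uv; rewrite -!cpE; exact: H1.
have -> : \prod_(u : 'I_m.+1 * bool + unit) corner_points (Y t) (X t) u =
    \prod_u flow (corner_points (m := m) c x u) (nu u) t.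
  by apply: eq_bigr => u _; rewrite cpE.
exact: H2.
Qed.

End FoldIdentity.

(** * The determinant *)

Definition extend_ord (T : Type) n (f : 'I_n -> T) (z : T) (k : nat) : T :=
  if insub k is Some i then f i else z.

Lemma extend_ordE (T : Type) n (f : 'I_n -> T) z (i : 'I_n) : extend_ord f z i = f i.
Proof. by rewrite /extend_ord valK. Qed.

Lemma prod_lt_pairs (K : comNzRingType) n (F : nat -> nat -> K) :
  \prod_(j < n) \prod_(i < j) F i j = \prod_(i < n) \prod_(j < n | (i < j)%N) F i j.
Proof.
rewrite [RHS](exchange_big_dep xpredT) //=; apply: eq_bigr => j _.
by rewrite (big_ord_widen n (fun i => F i j)) // ltnW.
Qed.

Lemma exprz_1subS (F : fieldType) (t : F) m : t ^ (1 - m.+1%:Z) = t ^- m.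
Proof.
have -> : 1 - m.+1%:Z = - m%:Z :> int by rewrite intS opprD addrA subrr add0r.
by rewrite exprnN.
Qed.

Lemma solve_determinant_alg (F : fieldType) (D A T pr s2 pa ca Pq q2 cc xx vv aa : F) :
  A = - (T / (ca * pa)) -> T != 0 -> ca != 0 -> pa != 0 ->
  A * D = Pq * aa * (2 * q2 * cc * xx * vv) ->
  D = - (2 * pa * ca / T) * Pq * q2 * cc * xx * (aa * vv).
Proof.
move=> AE T0 c0 pa0 H.
have A0 : A != 0 by rewrite AE oppr_eq0 mulf_neq0 // invr_eq0 mulf_neq0.
apply: (mulfI A0); rewrite H AE; field.
by apply/and3P.
Qed.

(* Indices are shifted to start from 0: the paper's P_j (1 <= j <= n) is P at
   the ordinal of value j - 1, so that ordinal j carries an A_j theta function,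
   that is A_theta with m = j.+1. *)
Theorem corollary4p14 (R : realType) (p : R[i]) (hp : 0 < `|p| < 1)
    (n : nat) (hn : (0 < n)%N)
    (x a : 'I_n -> R[i]) (c : 'I_n.-1 -> R[i])
    (hx : forall i, x i != 0) (ha : forall i, a i != 0)
    (hc : forall k, c k != 0)
    (hgen : theta p ((\prod_(k < n.-1) c k) * \prod_(k < n) a k) != 0)
    (P : 'I_n -> R[i] -> R[i])
    (hP : forall j : 'I_n,
       A_theta p j.+1
         ((\prod_(k < n.-1) c k) * \prod_(k < n | (j < k)%N) a k)^-1 (P j)) :
  \det (\matrix_(i < n, j < n)
    (x i ^ (1 - n%:Z) * (\prod_(k < n.-1) theta p (c k * x i))
       * P j (x i) * \prod_(k < n | (j < k)%N) theta p (a k * x i)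
     - x i ^+ n * (\prod_(k < n.-1) theta p (c k * (x i)^-1))
       * P j (x i)^-1 * \prod_(k < n | (j < k)%N) theta p (a k * (x i)^-1)))
  = - (2 * (\prod_(i < n) a i) * (\prod_(k < n.-1) c k)
       / theta p ((\prod_(k < n.-1) c k) * \prod_(i < n) a i))
    * (\prod_(i < n) P i (1 / a i))
    * (\prod_(i < n.-1) (theta p (- c i) * theta (p ^+ 2) (p * c i ^+ 2)))
    * (\prod_(i < n.-1) \prod_(j < n.-1 | (i < j)%N) theta p (c i * c j))
    * (\prod_(i < n) theta p (x i))
    * (\prod_(i < n) \prod_(j < n | (i < j)%N)
         (a j * (x i)^-1 * theta_pm p (x i) (x j))).
Proof.
have [p0 p1] : p != 0 /\ normc p < 1.
  by move: hp; rewrite normr_gt0 normrc ltcR => /andP[].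
case: n hn x a c hx ha hc hgen P hP => // m _; rewrite [m.+1.-1]/= => x a c hx ha hc hgen P hP.
pose X := extend_ord x 1; pose A := extend_ord a 1; pose C := extend_ord c 1.
pose Q := extend_ord P (fun=> 0).
have ext0 n (f : 'I_n -> R[i]) k : (forall i, f i != 0) -> extend_ord f 1 k != 0.
  by move=> f0; rewrite /extend_ord; case: insub => //; exact: oner_neq0.
have X0 i : X i != 0 by exact: ext0.
have A0 i : A i != 0 by exact: ext0.
have C0 i : C i != 0 by exact: ext0.
have XE (i : 'I_m.+1) : x i = X i by rewrite /X extend_ordE.
have AE (i : 'I_m.+1) : a i = A i by rewrite /A extend_ordE.
have CE (i : 'I_m) : c i = C i by rewrite /C extend_ordE.
have QE (i : 'I_m.+1) : P i = Q i by rewrite /Q extend_ordE.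
have prodA : \prod_(i < m.+1) a i = \prod_(i < m.+1) A i.
  by apply: eq_bigr => i _; rewrite AE.
have prodC : \prod_(i < m) c i = \prod_(i < m) C i.
  by apply: eq_bigr => i _; rewrite CE.
have hQ : typeA_data p m.+1 (\prod_(k < m) C k) A Q.
  move=> j jm; have /A_theta_space := hP (Ordinal jm).
  rewrite QE prodC /=.
  have -> : \prod_(k < m.+1 | (j < k)%N) a k = \prod_(k < m.+1 | (j < k)%N) A k.
    by apply: eq_bigr => k _; rewrite AE.
  exact.
rewrite prodA prodC in hgen *.
set T := theta p _ in hgen *.
have PC0 : \prod_(k < m) C k != 0 by apply/prodf_neq0.
have PA0 : \prod_(k < m.+1) A k != 0 by apply/prodf_neq0.
have TE : theta p ((\prod_(k < m) C k) * \prod_(i < m.+1) A i)^-1 =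
    - (T / ((\prod_(k < m) C k) * \prod_(i < m.+1) A i)).
  by rewrite theta_inv // mulf_neq0.
have hA : theta p ((\prod_(k < m) C k) * \prod_(i < m.+1) A i)^-1 != 0.
  by rewrite TE oppr_eq0 mulf_neq0 // invr_eq0 mulf_neq0.
have := fold_det_sum p0 p1 A0 X0 C0 hQ hA.
rewrite fold_sum_eval // /typeB_denominator.
have -> : \det (\matrix_(i < m.+1, j < m.+1)
    (x i ^ (1 - m.+1%:Z) * (\prod_(k < m) theta p (c k * x i))
       * P j (x i) * \prod_(k < m.+1 | (j < k)%N) theta p (a k * x i)
     - x i ^+ m.+1 * (\prod_(k < m) theta p (c k * (x i)^-1))
       * P j (x i)^-1 * \prod_(k < m.+1 | (j < k)%N) theta p (a k * (x i)^-1)))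
  = fold_det p m C A Q X.
  rewrite /fold_det; congr (\det _); apply/matrixP => i j; rewrite !mxE.
  rewrite /fold_fun /fold_coef /tail_thetas exprz_1subS XE QE.
  have e1 t : \prod_(k < m) theta p (c k * t) = \prod_(k < m) theta p (C k * t).
    by apply: eq_bigr => k _; rewrite CE.
  have e2 t : \prod_(k < m.+1 | (j < k)%N) theta p (a k * t) =
      \prod_(k < m.+1 | (j < k)%N) theta p (A k * t).
    by apply: eq_bigr => k _; rewrite AE.
  rewrite (e1 (X i)) (e1 (X i)^-1) (e2 (X i)) (e2 (X i)^-1).
  by rewrite mulNr !mulrA.
have -> : \prod_(i < m.+1) P i (1 / a i) = \prod_(i < m.+1) Q i (A i)^-1.
  by apply: eq_bigr => i _; rewrite QE AE div1r.
have -> : \prod_(i < m) (theta p (- c i) * theta (p ^+ 2) (p * c i ^+ 2)) =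
    \prod_(i < m) (theta p (- C i) * theta (p ^+ 2) (p * C i ^+ 2)).
  by apply: eq_bigr => i _; rewrite CE.
have -> : \prod_(i < m) \prod_(j < m | (i < j)%N) theta p (c i * c j) =
    \prod_(j < m) \prod_(i < j) theta p (C i * C j).
  rewrite (prod_lt_pairs m (fun i j => theta p (C i * C j))).
  by apply: eq_bigr => i _; apply: eq_bigr => j _; rewrite !CE.
have -> : \prod_(i < m.+1) theta p (x i) = \prod_(i < m.+1) theta p (X i).
  by apply: eq_bigr => i _; rewrite XE.
have -> : \prod_(i < m.+1) \prod_(j < m.+1 | (i < j)%N)
         (a j * (x i)^-1 * theta_pm p (x i) (x j)) = \prod_(i < m.+1) A i ^+ i *
    \prod_(j < m.+1) \prod_(i < j) ((X i)^-1 * theta_pm p (X i) (X j)).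
  have -> : \prod_(j < m.+1) A j ^+ j = \prod_(j < m.+1) \prod_(i < j) A j.
    by apply: eq_bigr => j _; rewrite prodr_const card_ord.
  rewrite (prod_lt_pairs m.+1 (fun _ j => A j)).
  rewrite (prod_lt_pairs m.+1 (fun i j => (X i)^-1 * theta_pm p (X i) (X j))).
  rewrite -big_split; apply: eq_bigr => i _; rewrite -big_split.
  by apply: eq_bigr => j _; rewrite !XE AE -mulrA.
exact: solve_determinant_alg.
Qed.
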